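(* Let $E\to M$ be a nonzero vector bundle, let $A\subset\mathcal{T}=TM\oplus E$ be a nonzero projective Lie algebroid and $L^A\subset\mathcal{E}=\mathfrak{D}E\oplus\mathfrak{J}E$ its lifted Dirac structure. For any $X\in N_{L^A}$, the $1$-cochain $\omega_X=(X,\cdot)_E:L^A\to E$ is a coboundary (i.e. $\omega_X=d_{L^A}u$ for some $u\in\Gamma(E)$) if and only if $X_\bullet|_A\in\mathrm{Inn}(A)$.
   Context: Omni-Lie algebroid. $\mathfrak{D}E$ is the gauge Lie algebroid of $E$: its sections are the $\mathbb{R}$-linear operators $\mathfrak{d}:\Gamma(E)\to\Gamma(E)$ for which there is a vector field $\alpha(\mathfrak{d})$ with $\mathfrak{d}(fu)=f\mathfrak{d}u+\alpha(\mathfrak{d})(f)u$; the bracket $[\cdot,\cdot]_{\mathfrak{D}}$ is the commutator and the anchor is $\alpha:\mathfrak{D}E\to TM$. (The same notation $\mathfrak{D}V$ is used for any vector bundle $V$.) $\mathfrak{J}E$ is the first jet bundle of $E$ with projection $\mathbf{p}:\mathfrak{J}E\to E$ and $\ker\mathbf{p}=\mathrm{Hom}(TM,E)$. For $u\in\Gamma(E)$, $\mathbf{d}u\in\Gamma(\mathfrak{J}E)$ denotes its first jet; $\mathrm{Hom}(TM,E)$ is embedded so that $\mathbf{d}(fu)=f\,\mathbf{d}u+df\otimes u$. There is a nondegenerate $C^\infty(M)$-bilinear $E$-valued pairing with $\langle\mathbf{d}u,\mathfrak{d}\rangle_E=\langle\mathfrak{d},\mathbf{d}u\rangle_E=\mathfrak{d}u$.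 For $\mathfrak{d}\in\Gamma(\mathfrak{D}E)$ and $\mu\in\Gamma(\mathfrak{J}E)$, the Lie derivative $\mathfrak{L}_{\mathfrak{d}}\mu\in\Gamma(\mathfrak{J}E)$ is defined by $\langle\mathfrak{L}_{\mathfrak{d}}\mu,\mathfrak{d}'\rangle_E=\mathfrak{d}\langle\mu,\mathfrak{d}'\rangle_E-\langle\mu,[\mathfrak{d},\mathfrak{d}']_{\mathfrak{D}}\rangle_E$. On $\mathcal{E}=\mathfrak{D}E\oplus\mathfrak{J}E$ let $\rho:\mathcal{E}\to\mathfrak{D}E$ be the projection, $$\{\mathfrak{d}+\mu,\mathfrak{r}+\nu\}=[\mathfrak{d},\mathfrak{r}]_{\mathfrak{D}}+\mathfrak{L}_{\mathfrak{d}}\nu-\mathfrak{L}_{\mathfrak{r}}\mu+\mathbf{d}\langle\mu,\mathfrak{r}\rangle_E,\qquad (\mathfrak{d}+\mu,\mathfrak{r}+\nu)_E=\tfrac12(\langle\mathfrak{d},\nu\rangle_E+\langle\mathfrak{r},\mu\rangle_E).$$ The bundle map $\mathbf{b}:\mathcal{E}\to\mathcal{T}$ is $\mathbf{b}(\mathfrak{d}+\mu)=\alpha(\mathfrak{d})+\mathbf{p}(\mu)$. For a subbundle $S\subset\mathcal{E}$, $S^\perp=\{X\in\mathcal{E}: (X,s)_E=0\ \forall s\in S\}$. A Dirac structure is a subbundle $L$ that is maximal isotropic (equivalently $L=L^\perp$) with $\{\Gamma(L),\Gamma(L)\}\subset\Gamma(L)$; it is a Lie algebroid with the restricted bracket and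 anchor $\alpha\circ\rho$, and $\rho_L=\rho|_L:L\to\mathfrak{D}E$ is a representation of $L$ on $E$. $d_L$ is the Lie algebroid coboundary operator on $\Gamma(\mathrm{Hom}(\wedge^\bullet L,E))$ of this representation; in degree $0$, $(d_Lu)(l)=\rho_L(l)u$. $L$ is reducible if $\mathbf{b}(L)$ has constant rank. A projective Lie algebroid is a subbundle $A\subset TM\oplus E$ with a Lie algebroid structure $(A,[\cdot,\cdot]_A,\rho_A)$ whose anchor is $\rho_A=pr_{TM}|_A$. Its lifted Dirac structure $L^A$ is the unique reducible Dirac structure $L\subset\mathcal{E}$ with $\mathbf{b}(L)=A$ and $\mathbf{b}\{X,Y\}=[\mathbf{b}X,\mathbf{b}Y]_A$ for all $X,Y\in\Gamma(L)$ (it exists). The normalizer of a subbundle $C\subset\mathcal{E}$ is $N_C=\{X\in\Gamma(\mathcal{E}): \{X,Y\}\in\Gamma(C)\ \forall\, Y\in\Gamma(C)\}$. The falling operator $(\cdot)_\bullet:\Gamma(\mathcal{E})\to\Gamma(\mathfrak{D}\mathcal{T})$ is $X_\bullet(t)=\mathbf{b}\{X,Y\}$ for $t\in\Gamma(\mathcal{T})$ and any $Y\in\Gamma(\mathcal{E})$ with $\mathbf{b}(Y)=t$ (well defined). $X_\bullet|_A$ is its restriction to $\Gamma(A)$. $\mathrm{Inn}(A)=\{[a,\cdot]_A: a\in\Gamma(A)\}$. *)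

(* Defs.v *)
From HB Require Import structures.
From mathcomp Require Import all_boot all_order all_algebra.
From mathcomp Require Import all_classical all_reals all_analysis.

Set Implicit Arguments.
Unset Strict Implicit.
Unset Printing Implicit Defensive.

Import Order.TTheory GRing.Theory Num.Theory numFieldNormedType.Exports.

Local Open Scope classical_set_scope.
Local Open Scope ring_scope.

Lemma near_eq_differentiable (R : realType) (V W : normedModType R)
  (f g : V -> W) (x : V) : (\forall y \near x, f y = g y) ->
  differentiable f x -> differentiable g x.
Proof.
move=> fg [[dfc fE]]; apply/diffP.
apply: (@getPex _ (fun (df : {linear V -> W}) => continuous df /\
  forall y, g y = g (lim (nbhs x)) + df (y - lim (nbhs x))
                  +o_(y \near x) (y - lim (nbhs x)))).
exists ('d f x); split=> //; suff gE : g = cst (g (lim (nbhs x))) +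
    'd f x \o center (lim (nbhs x)) +o_x (center (lim (nbhs x))).
  by move=> y; rewrite {1}gE.
apply/eqaddoP => _/posnumP[e]; move/eqaddoP : fE => /(_ e%:num (gt0 e)) H.
near=> y.
rewrite !fctE lim_id// -(nbhs_singleton fg) -(_ : f y = g y); last by near: y.
near: y; apply: filterS H => y; by rewrite !fctE lim_id.
Unshelve. all: by end_near. Qed.

Section SmoothFunctions.
Context {R : realType} {n : nat}.
Implicit Types (f g : 'rV[R]_n -> R) (x : 'rV[R]_n).

(* [f] is [k] times differentiable on a neighbourhood of [x].  On an open set,
   being [k] times differentiable for every [k] is the same as being C^oo. *)
Fixpoint diff_near (k : nat) f x : Prop :=
  if k is k'.+1 then
    (\forall y \near x, differentiable f y) /\
    forall v, diff_near k' (fun y => 'D_v f y) x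
  else True.

Definition smooth_at f x := forall k, diff_near k f x.

Lemma diff_near_eq k f g x : (\forall y \near x, f y = g y) ->
  diff_near k f x -> diff_near k g x.
Proof.
elim: k f g x => //= k IH f g x fg [df Df]; split.
  near=> y; apply: (@near_eq_differentiable _ _ _ f g) => //.
    by near: y; exact: (nbhs_interior fg).
  by near: y.
move=> v; apply: IH (Df v).
near=> y; apply: near_eq_derive.
by near: y; exact: (nbhs_interior fg).
Unshelve. all: by end_near. Qed.

Lemma diff_nearW k f x : diff_near k.+1 f x -> diff_near k f x.
Proof.
elim: k f x => //= k IH f x [df Df]; split=> // v; exact: IH (Df v).
Qed.

Lemma diff_near_cst k (c : R) x : diff_near k (fun=> c) x.
Proof.
elim: k c x => //= k IH c x; split.
  by near=> y; exact: differentiable_cst.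
move=> v; apply: diff_near_eq (IH 0 x).
by near=> y; rewrite derive_cst.
Unshelve. all: by end_near. Qed.

Lemma diff_nearD k f g x :
  diff_near k f x -> diff_near k g x -> diff_near k (fun y => f y + g y) x.
Proof.
elim: k f g x => //= k IH f g x [df Df] [dg Dg]; split.
  by near=> y; apply: differentiableD; near: y.
move=> v; apply: diff_near_eq (IH _ _ _ (Df v) (Dg v)).
by near=> y; rewrite deriveD//; apply: diff_derivable; near: y.
Unshelve. all: by end_near. Qed.

Lemma diff_nearM k f g x :
  diff_near k f x -> diff_near k g x -> diff_near k (fun y => f y * g y) x.
Proof.
elim: k f g x => // k IH f g x Hf Hg.
have [df Df] := Hf; have [dg Dg] := Hg; split.
  by near=> y; apply: differentiableM; near: y.
move=> v; apply: diff_near_eq (diff_nearD (IH _ _ _ (diff_nearW Hf) (Dg v))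
                                          (IH _ _ _ (diff_nearW Hg) (Df v))).
by near=> y; rewrite deriveM//; apply: diff_derivable; near: y.
Unshelve. all: by end_near. Qed.

Lemma smooth_at_diff f x : smooth_at f x -> differentiable f x.
Proof. by case/(_ 1%N) => /nbhs_singleton. Qed.

End SmoothFunctions.

(* [chartV i] is the inverse of the chart [chart i : chart_dom i -> 'rV_n]; the values
   of [chart i] outside [chart_dom i] and of [chartV i] outside the image of [chart_dom i]
   are irrelevant. *)
Record manifold (R : realType) (n : nat) := Manifold {
  carrier :> topologicalType;
  manifold_hausdorff : hausdorff_space carrier;
  manifold_second_countable : @second_countable carrier;
  chart_index : Type;
  chart_dom : chart_index -> set carrier;
  chart : chart_index -> carrier -> 'rV[R]_n;
  chartV : chart_index -> 'rV[R]_n -> carrier;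
  dom_open : forall i, open (chart_dom i);
  dom_cover : forall x, exists i, chart_dom i x;
  chart_open : forall i, open (chart i @` chart_dom i);
  chartK : forall i x, chart_dom i x -> chartV i (chart i x) = x;
  chart_continuous : forall i x, chart_dom i x -> {for x, continuous (chart i)};
  chartV_continuous : forall i x, chart_dom i x ->
    {for chart i x, continuous (chartV i)};
  chart_transition : forall i j x, chart_dom i x -> chart_dom j x -> forall k,
    smooth_at (fun z => chart j (chartV i z) 0 k) (chart i x)
}.

Section Manifold.
Context {R : realType} {n : nat} {M : manifold R n}.

Definition smooth_fun (f : M -> R) := forall i x, chart_dom i x ->
  smooth_at (f \o chartV i) (chart i x).

Record Cinf := MkCinf { Cinf_fun :> M -> R; CinfP : smooth_fun Cinf_fun }.

Lemma smooth_fun_cst (c : R) : smooth_fun (fun=> c).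
Proof. by move=> i x _ k; exact: diff_near_cst. Qed.

Definition Cinf_cst c := MkCinf (smooth_fun_cst c).

End Manifold.
Arguments Cinf {R n} M.

(* A family of vector spaces with a C^oo(M)-module of smooth sections.  The
   bundles built below are E itself (a locally trivial vector bundle) and the
   bundles TM, DE, JE, ... derived from it. *)
Record bundle (R : realType) (n : nat) (M : manifold R n) := Bundle {
  fib :> M -> lmodType R;
  smooth_sec : set (forall x, fib x);
  smooth_sec0 : smooth_sec (fun=> 0);
  smooth_secD : forall s t, smooth_sec s -> smooth_sec t ->
    smooth_sec (fun x => s x + t x);
  smooth_secZ : forall (f : Cinf M) s, smooth_sec s ->
    smooth_sec (fun x => f x *: s x)
}.

Record sec (R : realType) (n : nat) (M : manifold R n) (V : bundle M) := Sec {
  sec_fun :> forall x, V x;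
  secP : smooth_sec sec_fun
}.

Section Sections.
Context {R : realType} {n : nat} {M : manifold R n} (V : bundle M).
Implicit Types s t u : sec V.

Lemma sec_eq s t : (forall x, s x = t x) -> s = t.
Proof.
case: s t => [s Ps] [t Pt] /= st.
have {}st : s = t by apply: functional_extensionality_dep.
by subst t; congr Sec; exact: Prop_irrelevance.
Qed.

HB.instance Definition _ := gen_eqMixin (sec V).
HB.instance Definition _ := gen_choiceMixin (sec V).

Lemma smooth_sec_scale (c : R) s : smooth_sec (fun x => c *: s x).
Proof. exact: (smooth_secZ (Cinf_cst c) (@secP _ _ _ _ s)). Qed.

Definition sec0 : sec V := Sec (@smooth_sec0 _ _ _ V).
Definition sec_add s t : sec V := Sec (smooth_secD (secP s) (secP t)).
Definition sec_scale c s : sec V := Sec (smooth_sec_scale c s).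
Definition sec_opp s : sec V := sec_scale (-1) s.

Lemma sec_addA : associative sec_add.
Proof. by move=> s t u; apply: sec_eq => x; exact: addrA. Qed.
Lemma sec_addC : commutative sec_add.
Proof. by move=> s t; apply: sec_eq => x; exact: addrC. Qed.
Lemma sec_add0 : left_id sec0 sec_add.
Proof. by move=> s; apply: sec_eq => x; exact: add0r. Qed.
Lemma sec_addN : left_inverse sec0 sec_opp sec_add.
Proof. by move=> s; apply: sec_eq => x /=; rewrite scaleN1r addNr. Qed.

HB.instance Definition _ := GRing.isZmodule.Build (sec V)
  sec_addA sec_addC sec_add0 sec_addN.

Lemma sec_scaleA a b s : sec_scale a (sec_scale b s) = sec_scale (a * b) s.
Proof. by apply: sec_eq => x; exact: scalerA. Qed.
Lemma sec_scale1 : left_id 1 sec_scale.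
Proof. by move=> s; apply: sec_eq => x; exact: scale1r. Qed.
Lemma sec_scaleDr : right_distributive sec_scale +%R.
Proof. by move=> a s t; apply: sec_eq => x; exact: scalerDr. Qed.
Lemma sec_scaleDl s : {morph sec_scale^~ s : a b / a + b}.
Proof. by move=> a b; apply: sec_eq => x; exact: scalerDl. Qed.

HB.instance Definition _ := GRing.Zmodule_isLmodule.Build R (sec V)
  sec_scaleA sec_scale1 sec_scaleDr sec_scaleDl.

Definition fmul (f : Cinf M) s : sec V := Sec (smooth_secZ f (secP s)).

(* The section with values [s x]; it is 0 if [s] is not smooth, and is only
   used below for families [s] that are smooth. *)
Definition mksec (s : forall x, V x) : sec V :=
  if pselect (smooth_sec s) is left Ps then Sec Ps else 0.

End Sections.

Section DirectSum.
Context {R : realType} {n : nat} {M : manifold R n} (V W : bundle M).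

Definition dsum_fib (x : M) : lmodType R := (V x * W x)%type.

Definition dsum_smooth (s : forall x, dsum_fib x) :=
  smooth_sec (fun x => (s x).1) /\ smooth_sec (fun x => (s x).2).

Lemma dsum_smooth0 : dsum_smooth (fun=> 0).
Proof. by split; exact: smooth_sec0. Qed.

Lemma dsum_smoothD s t : dsum_smooth s -> dsum_smooth t ->
  dsum_smooth (fun x => s x + t x).
Proof. by move=> [s1 s2] [t1 t2]; split; exact: smooth_secD. Qed.

Lemma dsum_smoothZ (f : Cinf M) s : dsum_smooth s ->
  dsum_smooth (fun x => f x *: s x).
Proof. by move=> [s1 s2]; split; exact: smooth_secZ. Qed.

Definition dsum : bundle M := Bundle dsum_smooth0 dsum_smoothD dsum_smoothZ.

Definition sec_fst (X : sec dsum) : sec V := Sec (secP X).1.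
Definition sec_snd (X : sec dsum) : sec W := Sec (secP X).2.

Lemma sec_pair_smooth (s : sec V) (t : sec W) :
  dsum_smooth (fun x => (s x, t x)).
Proof. by split; exact: secP. Qed.

Definition sec_pair (s : sec V) (t : sec W) : sec dsum :=
  Sec (sec_pair_smooth s t : smooth_sec (b := dsum) _).

End DirectSum.

Section Tangent.
Context {R : realType} {n : nat} {M : manifold R n}.

(* A tangent vector at [x] is a directional derivative operator at [x]: in every
   chart around [x] it is a combination of the coordinate derivatives. *)
Definition is_tangent (x : M) : pred (Cinf M -> R^o) := fun v =>
  `[< forall i, chart_dom i x -> exists w : 'rV[R]_n, forall f : Cinf M,
      v f = 'D_w (f \o chartV i) (chart i x) >].

Lemma is_tangent_submod x : subsemimod_closed (is_tangent x).
Proof.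
have dif (f : Cinf M) i : chart_dom i x -> differentiable (f \o chartV i) (chart i x).
  by move=> ix; apply: smooth_at_diff; exact: CinfP.
split; [split|].
- apply/asboolP => i ix; exists 0 => f.
  by rewrite deriveE ?linear0//; exact: dif.
- move=> v v' /asboolP tv /asboolP tv'; apply/asboolP => i ix.
  have [w vw] := tv i ix; have [w' vw'] := tv' i ix.
  exists (w + w') => f; have := dif f i ix => df.
  by rewrite deriveE// linearD -!deriveE// -vw -vw'.
- move=> c v /asboolP tv; apply/asboolP => i ix; have [w vw] := tv i ix.
  exists (c *: w) => f; have := dif f i ix => df.
  by rewrite deriveE// linearZ -!deriveE// -vw.
Qed.

Record tangent (x : M) := Tangent {
  tangent_fun :> Cinf M -> R^o;
  tangentP : is_tangent x tangent_fun
}.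

HB.instance Definition _ x := [isSub for @tangent_fun x].
HB.instance Definition _ x := [Choice of tangent x by <:].
HB.instance Definition _ x :=
  GRing.SubChoice_isSubLmodule.Build R (Cinf M -> R^o) (is_tangent x)
    (tangent x) (is_tangent_submod x).

Definition TM_smooth (v : forall x, tangent x) :=
  forall f, smooth_fun (fun x => v x f).

Lemma TM_smooth0 : TM_smooth (fun=> 0).
Proof. by move=> f; exact: smooth_fun_cst. Qed.

Lemma TM_smoothD v w : TM_smooth v -> TM_smooth w ->
  TM_smooth (fun x => v x + w x).
Proof.
by move=> sv sw f i x ix k; apply: diff_nearD; [exact: sv|exact: sw].
Qed.

Lemma TM_smoothZ (f : Cinf M) v : TM_smooth v ->
  TM_smooth (fun x => f x *: v x).
Proof.
by move=> sv g i x ix k; apply: diff_nearM; [exact: CinfP|exact: sv].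
Qed.

Definition TM : bundle M :=
  @Bundle R n M (fun x => tangent x : lmodType R) _
    TM_smooth0 TM_smoothD TM_smoothZ.

Definition vderiv (v : sec TM) (f : Cinf M) : Cinf M := MkCinf (secP v f).

End Tangent.
Arguments tangent {R n M} x.
Arguments TM {R n} M.

Section Gauge.
Context {R : realType} {n : nat} {M : manifold R n} (V : bundle M).

Definition has_symbol x (d : sec V -> V x) (v : tangent x) :=
  forall (f : Cinf M) (u : sec V), d (fmul f u) = f x *: d u + v f *: u x.

Definition is_gauge x : pred (sec V -> V x) := fun d =>
  `[< (forall (c : R) u u', d (c *: u + u') = c *: d u + d u') /\
      exists v, has_symbol d v >].

Lemma is_gauge_submod x : subsemimod_closed (@is_gauge x).
Proof.
split; [split|].
- apply/asboolP; split=> [c u u'|]; first by rewrite /= scaler0 addr0.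
  by exists 0 => f u; rewrite /= scaler0 scale0r addr0.
- move=> d d' /asboolP[ld [v dv]] /asboolP[ld' [v' dv']]; apply/asboolP; split.
    move=> c u u'; rewrite /= !fctE ld ld' scalerDr.
    by rewrite addrACA.
  exists (v + v') => f u; rewrite !fctE dv dv' scalerDr scalerDl.
  by rewrite addrACA.
- move=> c d /asboolP[ld [v dv]]; apply/asboolP; split.
    move=> a u u'; rewrite !fctE ld scalerDr.
    by rewrite !scalerA mulrC.
  exists (c *: v) => f u; rewrite !fctE dv scalerDr !scalerA.
  by rewrite mulrC.
Qed.

Record gauge_at (x : M) := GaugeAt {
  gauge_fun :> sec V -> V x;
  gaugeP : is_gauge gauge_fun
}.

HB.instance Definition _ x := [isSub for @gauge_fun x].
HB.instance Definition _ x := [Choice of gauge_at x by <:].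
HB.instance Definition _ x :=
  GRing.SubChoice_isSubLmodule.Build R (sec V -> V x) (@is_gauge x)
    (gauge_at x) (@is_gauge_submod x).

(* The symbol is unique when V is a vector bundle of positive rank. *)
Definition anchor x (d : gauge_at x) : tangent x := xget 0 (has_symbol d).

(* By [gauge_act] below, the smooth sections of DV are the operators
   Gamma(V) -> Gamma(V) whose symbol is a smooth vector field. *)
Definition gauge_smooth (d : forall x, gauge_at x) :=
  (forall u, smooth_sec (fun x => d x u)) /\
  exists v : sec (TM M), forall x, has_symbol (d x) (v x).

Lemma gauge_smooth0 : gauge_smooth (fun=> 0).
Proof.
split=> [u|]; first exact: smooth_sec0.
by exists 0 => x f u /=; rewrite scaler0 scale0r addr0.
Qed.

Lemma gauge_smoothD d d' : gauge_smooth d -> gauge_smooth d' ->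
  gauge_smooth (fun x => d x + d' x).
Proof.
move=> [sd [v dv]] [sd' [v' dv']]; split=> [u|].
  exact: (smooth_secD (sd u) (sd' u)).
exists (v + v') => x f u /=; rewrite !fctE dv dv' scalerDr scalerDl.
by rewrite addrACA.
Qed.

Lemma gauge_smoothZ (f : Cinf M) d : gauge_smooth d ->
  gauge_smooth (fun x => f x *: d x).
Proof.
move=> [sd [v dv]]; split=> [u|]; first exact: (smooth_secZ f (sd u)).
exists (fmul f v) => x g u /=; rewrite !fctE dv scalerDr !scalerA.
by rewrite mulrC.
Qed.

Definition gauge_bundle : bundle M :=
  @Bundle R n M (fun x => gauge_at x : lmodType R) _
    gauge_smooth0 gauge_smoothD gauge_smoothZ.

Definition gauge_act (d : sec gauge_bundle) (u : sec V) : sec V := Sec ((secP d).1 u).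

(* [insubd] and [mksec] only serve to see the gauge_comm as a section of DV. *)
Definition gauge_comm (d r : sec gauge_bundle) : sec gauge_bundle :=
  mksec (V := gauge_bundle) (fun x => insubd (0 : gauge_at x)
    (fun u => d x (gauge_act r u) - r x (gauge_act d u))).

End Gauge.
Arguments anchor {R n M V x} d.

(* [triv i x] is a local trivialization over [triv_dom i], extended by arbitrary
   linear maps outside [triv_dom i], and [trivV i x] is its inverse. *)
Record vector_bundle (R : realType) (n : nat) (M : manifold R n) (r : nat) :=
  VectorBundle {
  vfib : M -> lmodType R;
  triv_index : Type;
  triv_dom : triv_index -> set M;
  triv : triv_index -> forall x, {linear vfib x -> 'rV[R]_r};
  trivV : triv_index -> forall x, 'rV[R]_r -> vfib x;
  triv_dom_open : forall i, open (triv_dom i);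
  triv_cover : forall x, exists i, triv_dom i x;
  trivK : forall i x, triv_dom i x -> cancel (triv i x) (trivV i x);
  trivVK : forall i x, triv_dom i x -> cancel (trivV i x) (triv i x);
  triv_transition : forall i i' j x,
    triv_dom i x -> triv_dom i' x -> chart_dom j x -> forall (c : 'rV[R]_r) k,
    smooth_at (fun z => triv i' (chartV j z) (trivV i (chartV j z) c) 0 k)
      (chart j x)
}.

Section VectorBundle.
Context {R : realType} {n : nat} {M : manifold R n} {r : nat}
  (E : vector_bundle M r).

Definition coef (s : forall x, vfib E x) (i : triv_index E) (j : chart_index M)
    (k : 'I_r) : 'rV[R]_n -> R :=
  fun z => triv i (chartV j z) (s (chartV j z)) 0 k.

Definition vb_smooth (s : forall x, vfib E x) := forall i j x,
  triv_dom i x -> chart_dom j x -> forall k, smooth_at (coef s i j k) (chart j x).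

Lemma vb_smooth0 : vb_smooth (fun=> 0).
Proof.
move=> i j x _ _ k m; rewrite (_ : coef _ _ _ _ = fun=> 0).
  exact: diff_near_cst.
by apply/funext => z; rewrite /coef linear0 mxE.
Qed.

Lemma vb_smoothD s t : vb_smooth s -> vb_smooth t ->
  vb_smooth (fun x => s x + t x).
Proof.
move=> ss st i j x ix jx k m.
rewrite (_ : coef _ _ _ _ = fun z => coef s i j k z + coef t i j k z).
  by apply: diff_nearD; [exact: ss|exact: st].
by apply/funext => z; rewrite /coef linearD mxE.
Qed.

Lemma vb_smoothZ (f : Cinf M) s : vb_smooth s ->
  vb_smooth (fun x => f x *: s x).
Proof.
move=> ss i j x ix jx k m.
rewrite (_ : coef _ _ _ _ = fun z => (f \o chartV j) z * coef s i j k z).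
  by apply: diff_nearM; [exact: CinfP|exact: ss].
by apply/funext => z; rewrite /coef linearZ mxE.
Qed.

Definition vb_bundle : bundle M := Bundle vb_smooth0 vb_smoothD vb_smoothZ.

End VectorBundle.

Coercion vb_bundle : vector_bundle >-> bundle.

Section Jets.
Context {R : realType} {n : nat} {M : manifold R n} {r : nat}
  (E : vector_bundle M r).

(* The sections whose value and first derivatives vanish at [x]. *)
Definition vanish1 (x : M) (u : sec E) : bool :=
  `[< forall i j, triv_dom i x -> chart_dom j x -> forall k,
      coef u i j k (chart j x) = 0 /\
      forall w, 'D_w (coef u i j k) (chart j x) = 0 >].

Lemma vanish1_submod x : subsemimod_closed (vanish1 x).
Proof.
have dif (u : sec E) i j k w : triv_dom i x -> chart_dom j x ->
    derivable (coef u i j k) (chart j x) w.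
  move=> ix jx; apply/diff_derivable/smooth_at_diff.
  exact: (secP u : vb_smooth _).
split; [split|].
- apply/asboolP => i j ix jx k.
  rewrite (_ : coef _ _ _ _ = fun=> 0); first by split=> // w; exact: derive_cst.
  by apply/funext => z; rewrite /coef linear0 mxE.
- move=> u v /asboolP hu /asboolP hv; apply/asboolP => i j ix jx k.
  have [u0 du] := hu i j ix jx k; have [v0 dv] := hv i j ix jx k.
  rewrite (_ : coef _ _ _ _ = coef u i j k + coef v i j k).
    split=> [|w]; first by rewrite fctE u0 v0 addr0.
    by rewrite deriveD ?du ?dv ?addr0//; exact: dif.
  by apply/funext => z; rewrite /coef linearD mxE.
- move=> c u /asboolP hu; apply/asboolP => i j ix jx k.
  have [u0 du] := hu i j ix jx k.
  rewrite (_ : coef _ _ _ _ = c *: coef u i j k).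
    split=> [|w]; first by rewrite fctE u0 scaler0.
    by rewrite deriveZ ?du ?scaler0//; exact: dif.
  by apply/funext => z; rewrite /coef linearZ mxE.
Qed.

HB.instance Definition _ x := GRing.isSubmodClosed.Build R (sec E) (vanish1 x)
  (vanish1_submod x).

(* The fibre of JE at [x] is Gamma(E) modulo the sections vanishing to first
   order at [x]. *)
Definition jet_at (x : M) :=
  Quotient.quot (Algebra.ZmodClosed.clone (sec E) (vanish1 x) _).

HB.instance Definition _ x := GRing.Zmodule.on (jet_at x).

Local Open Scope quotient_scope.

Definition jet (x : M) (u : sec E) : jet_at x := \pi_(jet_at x) u.

Definition jet_scale x (c : R) (m : jet_at x) : jet_at x :=
  jet x (c *: repr m).

Lemma jet_eq x u v : (jet x u = jet x v) <-> vanish1 x (u - v).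
Proof.
by split=> [/eqP|h]; [rewrite -Quotient.idealrBE|apply/eqP; rewrite -Quotient.idealrBE].
Qed.

Lemma jetZ x c u : jet x (c *: u) = jet_scale c (jet x u).
Proof.
apply/jet_eq; rewrite -scalerBr; apply: (vanish1_submod x).2.
by apply/jet_eq; rewrite /jet reprK.
Qed.

Lemma jetD x u v : jet x (u + v) = jet x u + jet x v.
Proof. by rewrite /jet !piE. Qed.

Lemma jet_repr x (m : jet_at x) : jet x (repr m) = m.
Proof. by rewrite /jet reprK. Qed.

Lemma jet_scaleA x a b (m : jet_at x) :
  jet_scale a (jet_scale b m) = jet_scale (a * b) m.
Proof. by rewrite -[m]jet_repr -!jetZ scalerA. Qed.

Lemma jet_scale1 x : left_id 1 (@jet_scale x).
Proof. by move=> m; rewrite -[m]jet_repr -!jetZ scale1r. Qed.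

Lemma jet_scaleDr x : right_distributive (@jet_scale x) +%R.
Proof.
by move=> a m m'; rewrite -[m]jet_repr -[m']jet_repr -jetD -!jetZ scalerDr jetD.
Qed.

Lemma jet_scaleDl x (m : jet_at x) :
  {morph (@jet_scale x)^~ m : a b / a + b}.
Proof. by move=> a b; rewrite -[m]jet_repr -!jetZ scalerDl jetD. Qed.

HB.instance Definition _ x := GRing.Zmodule_isLmodule.Build R (jet_at x)
  (@jet_scaleA x) (@jet_scale1 x) (@jet_scaleDr x) (@jet_scaleDl x).

(* Smooth sections of JE are locally the C^oo(M)-combinations of jets of
   sections of E. *)
Definition jet_smooth (m : forall x, jet_at x) := forall x0 : M,
  exists l : seq (Cinf M * sec E), \forall x \near x0,
    m x = \sum_(p <- l) p.1 x *: jet x p.2.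

Lemma jet_smooth0 : jet_smooth (fun=> 0).
Proof. by move=> x0; exists [::]; near=> x; rewrite big_nil.
Unshelve. all: by end_near. Qed.

Lemma jet_smoothD m m' : jet_smooth m -> jet_smooth m' ->
  jet_smooth (fun x => m x + m' x).
Proof.
move=> sm sm' x0; have [l ml] := sm x0; have [l' ml'] := sm' x0.
exists (l ++ l'); near=> x; rewrite big_cat /=; congr (_ + _); by near: x.
Unshelve. all: by end_near. Qed.

Lemma CinfM_smooth (f g : Cinf M) : smooth_fun (fun x => f x * g x).
Proof. by move=> i x ix k; apply: diff_nearM; exact: CinfP. Qed.

Lemma jet_smoothZ (f : Cinf M) m : jet_smooth m ->
  jet_smooth (fun x => f x *: m x).
Proof.
move=> sm x0; have [l ml] := sm x0.
exists [seq (MkCinf (CinfM_smooth f p.1), p.2) | p <- l]; near=> x.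
rewrite big_map /= (_ : m x = \sum_(p <- l) p.1 x *: jet x p.2).
  by rewrite scaler_sumr; apply: eq_bigr => p _; rewrite scalerA.
by near: x.
Unshelve. all: by end_near. Qed.

Definition JE : bundle M :=
  @Bundle R n M (fun x => jet_at x : lmodType R) _
    jet_smooth0 jet_smoothD jet_smoothZ.

Lemma jet_sec_smooth (u : sec E) : jet_smooth (fun x => jet x u).
Proof.
move=> x0; exists [:: (Cinf_cst 1, u)]; near=> x.
by rewrite big_seq1 /= scale1r.
Unshelve. all: by end_near. Qed.

Definition jet_sec (u : sec E) : sec JE :=
  Sec (jet_sec_smooth u : smooth_sec (b := JE) _).

(* The projection p : JE -> E and the pairing of JE with DE; neither depends on
   the representative of the jet. *)
Definition jet_proj x (m : jet_at x) : E x := (repr m : sec E) x.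
Definition pairing x (m : jet_at x) (d : gauge_at E x) : E x := d (repr m).

Definition pairing_sec (m : sec JE) (d : sec (gauge_bundle E)) : sec E :=
  mksec (V := E) (fun x => pairing (m x) (d x)).

(* Existence follows from L_d (f *: j u) = f *: j (d u) + alpha(d)(f) *: j u, and
   uniqueness from the nondegeneracy of the pairing. *)
Definition lie_deriv (d : sec (gauge_bundle E)) (m : sec JE) : sec JE :=
  xget 0 [set m' | forall d' : sec (gauge_bundle E),
    pairing_sec m' d' = gauge_act d (pairing_sec m d') -
                        pairing_sec m (gauge_comm d d')].

End Jets.

Section Subbundles.
Context {R : realType} {n : nat} {M : manifold R n} {V : bundle M}.

Definition is_basis (W : lmodType R) (S : set W) k (e : 'I_k -> W) :=
  S = [set w | exists c : 'I_k -> R, w = \sum_i c i *: e i] /\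
  forall c : 'I_k -> R, \sum_i c i *: e i = 0 -> forall i, c i = 0.

Definition has_dim (W : lmodType R) (S : set W) k :=
  exists e : 'I_k -> W, is_basis S e.

(* Local frame criterion; multiplying by a bump function makes the sections of
   a local frame global. *)
Definition is_subbundle (S : forall x, set (V x)) (k : nat) :=
  forall x0 : M, exists e : 'I_k -> sec V,
    \forall x \near x0, is_basis (S x) (fun i => e i x).

Definition secs (S : forall x, set (V x)) : set (sec V) :=
  [set s | forall x, S x (s x)].

(* A Lie algebroid structure on the subbundle [S]; the values of the bracket
   outside Gamma(S) are irrelevant. *)
Record is_Lie_algebroid (S : forall x, set (V x))
    (br : sec V -> sec V -> sec V) (rho : sec V -> sec (TM M)) : Prop := {
  la_closed : forall a b, secs S a -> secs S b -> secs S (br a b);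
  la_linear : forall (c : R) a b b', secs S a -> secs S b -> secs S b' ->
    br a (c *: b + b') = c *: br a b + br a b';
  la_skew : forall a b, secs S a -> secs S b -> br a b = - br b a;
  la_jacobi : forall a b c, secs S a -> secs S b -> secs S c ->
    br a (br b c) = br (br a b) c + br b (br a c);
  la_leibniz : forall a b (f : Cinf M), secs S a -> secs S b ->
    br a (fmul f b) = fmul f (br a b) + fmul (vderiv (rho a) f) b;
  la_anchor : forall a b (f : Cinf M) x, secs S a -> secs S b ->
    rho (br a b) x f =
    rho a x (vderiv (rho b) f) - rho b x (vderiv (rho a) f)
}.

End Subbundles.

Section OmniLie.
Context {R : realType} {n : nat} {M : manifold R n} {r : nat}
  (E : vector_bundle M r).

Definition Tau : bundle M := dsum (TM M) E.
Definition omni : bundle M := dsum (gauge_bundle E) (JE E).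

Definition courant (X Y : sec omni) : sec omni :=
  let d := sec_fst X in let m := sec_snd X in
  let d' := sec_fst Y in let m' := sec_snd Y in
  sec_pair (gauge_comm d d')
    (lie_deriv d m' - lie_deriv d' m + jet_sec (pairing_sec m d')).

Definition omni_form x (X Y : omni x) : E x :=
  2^-1 *: (pairing Y.2 X.1 + pairing X.2 Y.1).

Definition bmap x (X : omni x) : Tau x := (anchor X.1, jet_proj X.2).

Definition bsec (X : sec omni) : sec Tau :=
  mksec (V := Tau) (fun x => bmap (X x)).

Definition perp (L : forall x, set (omni x)) x : set (omni x) :=
  [set X | forall s, L x s -> omni_form X s = 0].
Arguments perp : clear implicits.

(* "Maximal isotropic" is read as L = L^perp. *)
Record is_Dirac (L : forall x, set (omni x)) : Prop := {
  dirac_subbundle : exists k, is_subbundle L k;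
  dirac_perp : forall x, L x = perp L x;
  dirac_involutive : forall X Y, secs L X -> secs L Y -> secs L (courant X Y)
}.

Definition reducible (L : forall x, set (omni x)) :=
  exists k, forall x, has_dim (@bmap x @` L x) k.

Definition dL0 (u : sec E) x (l : omni x) : E x := (l.1 : gauge_at E x) u.

Definition is_coboundary (L : forall x, set (omni x))
    (w : forall x, omni x -> E x) :=
  exists u : sec E, forall x (l : omni x), L x l -> w x l = dL0 u l.

Definition normalizer (C : forall x, set (omni x)) : set (sec omni) :=
  [set X | forall Y, secs C Y -> secs C (courant X Y)].

(* A section of D(Tau) acts locally on Gamma(Tau), and every section of Tau is
   locally of the form b(Y), so these equations determine the operator. *)
Definition falling (X : sec omni) : sec (gauge_bundle Tau) :=
  xget 0 [set D : sec (gauge_bundle Tau) | forall Y, gauge_act D (bsec Y) = bsec (courant X Y)].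

Record projective_Lie_algebroid (k : nat) := ProjectiveLieAlgebroid {
  pla :> forall x, set (Tau x);
  pla_bracket : sec Tau -> sec Tau -> sec Tau;
  pla_subbundle : is_subbundle pla k;
  pla_Lie : is_Lie_algebroid pla pla_bracket (@sec_fst _ _ _ _ _)
}.

Record is_lifted k (A : projective_Lie_algebroid k)
    (L : forall x, set (omni x)) : Prop := {
  lifted_Dirac : is_Dirac L;
  lifted_reducible : reducible L;
  lifted_image : forall x, @bmap x @` L x = A x;
  lifted_bracket : forall X Y, secs L X -> secs L Y ->
    bsec (courant X Y) = pla_bracket A (bsec X) (bsec Y)
}.

Definition restr_inner k (A : projective_Lie_algebroid k)
    (D : sec Tau -> sec Tau) :=
  exists2 a, secs A a & forall a', secs A a' -> D a' = pla_bracket A a a'.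

End OmniLie.

(* Main.v *)
(* Idea. For X = d + m and Y = r + n, write v, w for the symbols of d, r.  Pairing the Lie
   derivatives with the identity operator gives
     b{X,Y} = ([v,w], d(p n) - r(p m) + <m,r>).
   If omega_X = d_L u, then l := X - 2 j(u) is orthogonal to L, hence lies in L, and
   b{j(u),Y} = 0 because <j(u),r> = r(u); so the falling operator of X is [b(l), .]_A on A.
   Conversely let it be [a, .]_A.  Lift a locally to a section l = d0 + m0 of L.  Then
   b{X,Y} = b{l,Y} for Y in L; replacing Y by fY shows that d and d0 have the same symbol
   (here A must be nonzero), so <n,d - d0> = (d - d0)(p n), and together with (l,Y)_E = 0
   the E-component of b{X,Y} = b{l,Y} reads 2 (X,Y)_E = r(p m - a_E).
   The Lie derivative and the falling operator are chosen by epsilon; they exist thanks to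
   bump functions, the symmetry of second derivatives (brackets of vector fields are vector
   fields), local connections on E, and the nondegeneracy of the pairing. *)
Require Import Defs.
From mathcomp Require Import all_boot all_order all_algebra.
From mathcomp Require Import all_classical all_reals all_analysis.
From mathcomp Require Import ring lra.

Set Implicit Arguments.
Unset Strict Implicit.
Unset Printing Implicit Defensive.

Import Order.TTheory GRing.Theory Num.Theory numFieldNormedType.Exports.

Local Open Scope classical_set_scope.
Local Open Scope ring_scope.

(** * Calculus of smooth functions *)

(** Functions and sections are global objects here, while coordinates, frames, connections and lifts
    are local. Each local construction is therefore cut off by a bump function. This loses nothing,
    because tangent vectors, gauge operators and the bracket of A depend only on germs; for the last
    two, apply the Leibniz rule to a function that is constant near the point. The falling operator
    has to act on an arbitrary section t of the sum of TM and E, and its construction avoids lifting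
    t. In b{X,Y} the terms <m,r> - r(p m) depend only on the symbol of r, since m - j(p m) projects
    to 0 in E; so the whole formula is one in b(Y), and it makes sense with t in place of b(Y). In
    the converse direction the potential is u = 1/2 (p m - a_E), made from X and a alone. The lift l
    serves only to check the equation at one point, so nothing has to be glued. A nonzero E is what
    makes symbols unique, and hence the anchor linear. *)

Section SmoothClosure.
Context {R : realType} {n : nat}.
Implicit Types (f g : 'rV[R]_n -> R) (x : 'rV[R]_n).

Lemma smooth_at_eq f g x : (\forall y \near x, f y = g y) ->
  smooth_at f x -> smooth_at g x.
Proof. by move=> fg sf k; exact: diff_near_eq (sf k). Qed.

Lemma smooth_at_cst (c : R) x : smooth_at (fun=> c) x.
Proof. by move=> k; exact: diff_near_cst. Qed.

Lemma smooth_atD f g x : smooth_at f x -> smooth_at g x ->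
  smooth_at (fun y => f y + g y) x.
Proof. by move=> sf sg k; exact: diff_nearD. Qed.

Lemma smooth_atM f g x : smooth_at f x -> smooth_at g x ->
  smooth_at (fun y => f y * g y) x.
Proof. by move=> sf sg k; exact: diff_nearM. Qed.

Lemma smooth_atZ (c : R) f x : smooth_at f x -> smooth_at (fun y => c * f y) x.
Proof. by move=> sf; apply: smooth_atM => //; exact: smooth_at_cst. Qed.

Lemma smooth_atB f g x : smooth_at f x -> smooth_at g x ->
  smooth_at (fun y => f y - g y) x.
Proof.
move=> sf sg; apply: (@smooth_at_eq (fun y => f y + (-1) * g y)).
  by near=> y; rewrite mulN1r.
by apply: smooth_atD => //; exact: smooth_atZ.
Unshelve. all: by end_near. Qed.

Lemma smooth_at_sum (I : Type) (s : seq I) (P : pred I)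
    (F : I -> 'rV[R]_n -> R) x : (forall i, smooth_at (F i) x) ->
  smooth_at (fun y => \sum_(i <- s | P i) F i y) x.
Proof.
move=> sF; elim: s => [|i s IH].
  apply: smooth_at_eq (smooth_at_cst 0 x).
  by near=> y; rewrite big_nil.
apply: (@smooth_at_eq (fun y => (if P i then F i y else 0) +
    \sum_(j <- s | P j) F j y)).
  by near=> y; rewrite big_cons; case: ifP; rewrite ?add0r.
by apply: smooth_atD => //; case: (P i) => //; exact: smooth_at_cst.
Unshelve. all: by end_near. Qed.

Lemma smooth_at_prod (I : Type) (s : seq I) (P : pred I)
    (F : I -> 'rV[R]_n -> R) x : (forall i, smooth_at (F i) x) ->
  smooth_at (fun y => \prod_(i <- s | P i) F i y) x.
Proof.
move=> sF; elim: s => [|i s IH].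
  apply: smooth_at_eq (smooth_at_cst 1 x).
  by near=> y; rewrite big_nil.
apply: (@smooth_at_eq (fun y => (if P i then F i y else 1) *
    \prod_(j <- s | P j) F j y)).
  by near=> y; rewrite big_cons; case: ifP; rewrite ?mul1r.
by apply: smooth_atM => //; case: (P i) => //; exact: smooth_at_cst.
Unshelve. all: by end_near. Qed.

Lemma smooth_at_derive f x v : smooth_at f x -> smooth_at ('D_v f) x.
Proof. by move=> sf k; case: (sf k.+1) => _ /(_ v). Qed.

Lemma smooth_at_near_diff f x : smooth_at f x ->
  \forall y \near x, differentiable f y.
Proof. by move=> /(_ 1%N)[]. Qed.

Lemma smooth_at_cvg f x : smooth_at f x -> {for x, continuous f}.
Proof. by move=> /smooth_at_diff/differentiable_continuous. Qed.

(** The derivative of [f^-1] is [- f^-1 * f^-1 * 'D_v f], which involves only [f^-1] and derivatives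
    of [f]; so order [k] of the inverse gives order [k.+1]. *)
Lemma diff_near_inv k f x : f x != 0 -> diff_near k f x ->
  diff_near k (fun y => (f y)^-1) x.
Proof.
move=> fx0; elim: k => //= k IH Hf; have [df Df] := Hf.
have fn0 : \forall y \near x, f y != 0.
  have /differentiable_continuous cf := nbhs_singleton df.
  have : nbhs (f x) [set c | c != 0].
    by apply: open_nbhs_nbhs; split => //; exact: open_neq.
  by move/cf.
split; first by near=> y; apply: differentiableV; near: y.
move=> v; have IH' := IH (diff_nearW Hf).
apply: diff_near_eq
  (diff_nearM (diff_near_cst k (-1) x) (diff_nearM (diff_nearM IH' IH') (Df v))).
near=> y; rewrite deriveV; last 2 first.
- by near: y.
- by apply: diff_derivable; near: y.
rewrite mulN1r scaleNr; congr (- (_ * _)).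
by rewrite expr2 invfM.
Unshelve. all: by end_near. Qed.

Lemma smooth_atV f x : f x != 0 -> smooth_at f x ->
  smooth_at (fun y => (f y)^-1) x.
Proof. by move=> fx0 sf k; exact: diff_near_inv. Qed.


Lemma derive_coord (i : 'I_n) x (v : 'rV[R]_n) :
  'D_v (fun z : 'rV[R]_n => z 0 i) x = v 0 i.
Proof.
have did : derivable (id : 'rV[R]_n -> 'rV[R]_n) x v by exact: derivable_id.
by have := derive_mx did; rewrite derive_id => /matrixP/(_ 0 i); rewrite mxE.
Qed.

Lemma smooth_at_coord (i : 'I_n) x : smooth_at (fun z : 'rV[R]_n => z 0 i) x.
Proof.
have dc y : differentiable (fun z : 'rV[R]_n => z 0 i) y.
  exact: differentiable_coord.
move=> [//|k]; split; first by near=> y; exact: dc.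
move=> v; apply: diff_near_eq (diff_near_cst k (v 0 i) x).
by near=> y; rewrite derive_coord.
Unshelve. all: by end_near. Qed.

End SmoothClosure.

(** * Composition of smooth maps between coordinate spaces *)

Section ChainRule.
Context {R : realType} {n m : nat}.
Implicit Types (g : 'rV[R]_n -> 'rV[R]_m) (h : 'rV[R]_m -> R).

Lemma differentiable_rV g x :
  (forall i, differentiable (fun z => g z 0 i) x) -> differentiable g x.
Proof.
move=> dg.
have -> : g = \sum_(i < m) (fun z => g z 0 i *: delta_mx 0 i).
  by apply/funext => z; rewrite fct_sumE; exact: row_sum_delta.
by apply: differentiable_sum => i; exact: differentiableZl.
Qed.

Lemma derive_rV_comp h g x v : differentiable h (g x) -> differentiable g x ->
  'D_v (h \o g) x = 'D_('D_v g x) h (g x).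
Proof.
move=> dh dg; rewrite deriveE; last exact: differentiable_comp.
by rewrite diff_comp//= [RHS]deriveE// [in RHS]deriveE.
Qed.

Lemma derive_rV_sum h g x v : differentiable h (g x) ->
    (forall i, differentiable (fun z => g z 0 i) x) ->
  'D_v (h \o g) x =
  \sum_i 'D_v (fun z => g z 0 i) x * 'D_(delta_mx 0 i) h (g x).
Proof.
move=> dh dg; have dg' := differentiable_rV dg.
rewrite derive_rV_comp// deriveE// (row_sum_delta ('D_v g x)) linear_sum.
apply: eq_bigr => i _; rewrite linearZ/= -deriveE// derive_mx ?mxE//.
exact: diff_derivable.
Qed.

Lemma derive_dir_sum h x v : differentiable h x ->
  'D_v h x = \sum_i v 0 i * 'D_(delta_mx 0 i) h x.
Proof.
move=> dh; rewrite deriveE// {1}(row_sum_delta v) linear_sum.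
by apply: eq_bigr => i _; rewrite linearZ/= -deriveE.
Qed.

(** The derivative of [h \o g] is a sum of products of derivatives of the components of [g] with
    partial derivatives of [h] taken along [g]. The induction therefore runs over all [h], with [g]
    fixed. *)
Lemma diff_near_comp k h g x : (forall i, smooth_at (fun z => g z 0 i) x) ->
  diff_near k h (g x) -> diff_near k (h \o g) x.
Proof.
move=> sg; elim: k h => //= k IH h [dh Dh].
have dgi : \forall y \near x, forall i, differentiable (fun z => g z 0 i) y.
  exact: (filter_forall _ (fun i => smooth_at_near_diff (sg i))).
have cg : {for x, continuous g}.
  exact/differentiable_continuous/differentiable_rV/(nbhs_singleton dgi).
have dhg : \forall y \near x, differentiable h (g y) by move/cg: dh.
split.
  near=> y; apply: differentiable_comp; last by near: y.
  by apply: differentiable_rV; near: y.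
move=> v; pose F i y := 'D_v (fun z => g z 0 i) y * 'D_(delta_mx 0 i) h (g y).
suff H : diff_near k (fun y => \sum_i F i y) x.
  by apply: diff_near_eq H; near=> y; rewrite derive_rV_sum//; near: y.
have HF i : diff_near k (F i) x.
  apply: diff_nearM; first exact: smooth_at_derive.
  exact: (IH _ (Dh _)).
elim: (index_enum _) => [|i s IHs].
  by apply: diff_near_eq (diff_near_cst k 0 x); near=> y; rewrite big_nil.
by apply: diff_near_eq (diff_nearD (HF i) IHs); near=> y; rewrite big_cons.
Unshelve. all: by end_near. Qed.

Lemma smooth_at_comp h g x : (forall i, smooth_at (fun z => g z 0 i) x) ->
  smooth_at h (g x) -> smooth_at (h \o g) x.
Proof. by move=> sg sh k; exact: diff_near_comp. Qed.

End ChainRule.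

(** * Symmetry of second derivatives *)

Section Schwarz.
Context {R : realType} {n : nat}.
Implicit Types (f : 'rV[R]_n -> R) (x a b : 'rV[R]_n).

Lemma dist_half2 (e A B C : R) :
  `|A - C| <= e / 2 -> `|B - C| <= e / 2 -> `|B - A| <= e.
Proof.
move=> AC BC; rewrite (le_trans (ler_distD C _ _))//.
by rewrite [leRHS]splitr lerD// distrC.
Qed.

Lemma is_derive_line f p v (t : R) : differentiable f (p + t *: v) ->
  is_derive t 1 (fun s : R => f (p + s *: v)) ('D_v f (p + t *: v)).
Proof.
move=> df.
have E : (fun h : R => h^-1 *: (f (p + (h *: 1 + t) *: v) - f (p + t *: v))) =
         (fun h : R => h^-1 *: (f (h *: v + (p + t *: v)) - f (p + t *: v))).
  by apply/funext => h; rewrite [_%:A]mulr1 scalerDl [in LHS]addrCA.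
have dv : derivable f (p + t *: v) v by exact: diff_derivable.
by split; [move: dv|]; rewrite /derivable /derive /= E.
Qed.

(** The mean value theorem is used twice: along [a] for the increment of [f] in direction [b], then
    along [b] for ['D_a f]. The second difference is symmetric in [a] and [b]; the corner [w] is a
    variable so that it can be reached in either order. *)
Lemma second_difference_MVT f x a b w (h : R) : 0 < h ->
    w = x + h *: b + h *: a ->
    (forall s t, 0 <= s <= h -> 0 <= t <= h ->
      differentiable f (x + s *: a + t *: b) /\
      differentiable ('D_a f) (x + s *: a + t *: b)) ->
  exists s t, [/\ 0 <= s <= h, 0 <= t <= h &
    f w - f (x + h *: a) - f (x + h *: b) + f x =
    'D_b ('D_a f) (x + s *: a + t *: b) * h * h].
Proof.
move=> h0 -> df.
have h1 : 0 <= h <= h by rewrite lexx ltW.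
have h2 : 0 <= (0 : R) <= h by rewrite lexx ltW.
have itv c : c \in `]0, h[%R -> 0 <= c <= h.
  by rewrite in_itv/= => /andP[c0 ch]; rewrite !ltW.
have itvc c : c \in `[0, h] -> 0 <= c <= h by rewrite in_itv.
have phi' s : 0 <= s <= h -> is_derive s 1
    (fun s : R => f (x + h *: b + s *: a) - f (x + s *: a))
    ('D_a f (x + s *: a + h *: b) - 'D_a f (x + s *: a)).
  move=> sh; rewrite addrAC; apply: is_deriveB.
    by apply: is_derive_line; rewrite addrAC; apply: (df _ _ _ _).1.
  by apply: is_derive_line; rewrite -[_ + _]addr0 -(scale0r b); apply: (df _ _ _ _).1.
have [||s sh E1] := @MVT R (fun s : R => f (x + h *: b + s *: a) - f (x + s *: a))
    (fun s => 'D_a f (x + s *: a + h *: b) - 'D_a f (x + s *: a)) 0 h h0.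
- by move=> s /itv; exact: phi'.
- by apply: derivable_within_continuous => s /itvc/phi'[].
have psi' t : 0 <= t <= h -> is_derive t 1
    (fun t : R => 'D_a f (x + s *: a + t *: b))
    ('D_b ('D_a f) (x + s *: a + t *: b)).
  by move=> th; apply: is_derive_line; apply: (df _ _ _ _).2 => //; exact: itv.
have [||t th E2] := @MVT R (fun t : R => 'D_a f (x + s *: a + t *: b))
    (fun t => 'D_b ('D_a f) (x + s *: a + t *: b)) 0 h h0.
- by move=> t /itv; exact: psi'.
- by apply: derivable_within_continuous => t /itvc/psi'[].
exists s, t; split; [exact: itv|exact: itv|].
move: E1 E2; rewrite !scale0r !addr0 !subr0 => E1 E2.
by rewrite -E2 -E1 opprB addrA addrAC.
Qed.

(** For small [h] one and the same second difference, divided by [h * h], is a value of either mixed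
    derivative at some point of a small parallelogram at [x]. By continuity both values are within
    [e / 2] of those at [x]. *)
Lemma derive_comm f x a b : smooth_at f x ->
  'D_a ('D_b f) x = 'D_b ('D_a f) x.
Proof.
move=> sf; apply/eqP; rewrite -subr_eq0; apply/eqP.
set l1 := 'D_a _ _; set l2 := 'D_b _ _.
apply/eqP; rewrite -normr_le0; apply/ler_addgt0Pr => e e0; rewrite add0r.
have cont c d : \forall y \near x, [/\ differentiable f y,
    differentiable ('D_c f) y & `|'D_d ('D_c f) x - 'D_d ('D_c f) y| <= e / 2].
  near=> y; split.
  - by near: y; exact: smooth_at_near_diff.
  - by near: y; exact/smooth_at_near_diff/smooth_at_derive.
  - near: y; have := smooth_at_cvg (smooth_at_derive d (smooth_at_derive c sf)).
    by move/cvgrPdist_le; apply; rewrite divr_gt0.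
(* A point of the parallelogram is at distance at most [h * (|c| + |d|)] from [x]. The [+ 1] in the
   bound on [h] keeps the denominator positive when [c] and [d] vanish. *)
have near2 (P : 'rV[R]_n -> Prop) c d : (\forall y \near x, P y) ->
    \forall h \near (0 : R)^'+, forall s t, 0 <= s <= h -> 0 <= t <= h ->
      P (x + s *: c + t *: d).
  move=> /nbhs_ballP[r /= r0 rP].
  have K : 0 < `|c| + `|d| + 1 by rewrite ltr_wpDl.
  near=> h => s t /andP[s0 sh] /andP[t0 th]; apply: rP.
  rewrite -ball_normE /= -addrA opprD addNKr normrN.
  rewrite (le_lt_trans (ler_normD _ _))// !normrZ !ger0_norm//.
  have : h < r / (`|c| + `|d| + 1).
    by near: h; apply: nbhs_right_lt; rewrite divr_gt0.
  rewrite ltr_pdivlMr// => hr.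
  have := ler_wpM2r (normr_ge0 c) sh; have := ler_wpM2r (normr_ge0 d) th.
  have h0 : 0 < h by [].
  by move: hr; lra.
suff [h [h0 H1 H2]] : exists h : R, [/\ 0 < h,
    (forall s t, 0 <= s <= h -> 0 <= t <= h ->
      [/\ differentiable f (x + s *: a + t *: b),
    differentiable ('D_a f) (x + s *: a + t *: b) &
     `|'D_b ('D_a f) x - 'D_b ('D_a f) (x + s *: a + t *: b)| <= e / 2]) &
    (forall s t, 0 <= s <= h -> 0 <= t <= h ->
      [/\ differentiable f (x + s *: b + t *: a),
    differentiable ('D_b f) (x + s *: b + t *: a) &
     `|'D_a ('D_b f) x - 'D_a ('D_b f) (x + s *: b + t *: a)| <= e / 2])].
  have [|s1 [t1 [s1h t1h E1]]] :=
      @second_difference_MVT f x a b (x + h *: b + h *: a) h h0 erefl.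
    by move=> s t sh th; have [] := H1 s t sh th.
  have [|s2 [t2 [s2h t2h E2]]] :=
      @second_difference_MVT f x b a (x + h *: b + h *: a) h h0 (addrAC _ _ _).
    by move=> s t sh th; have [] := H2 s t sh th.
  have [_ _ B1] := H1 _ _ s1h t1h; have [_ _ B2] := H2 _ _ s2h t2h.
  have E : 'D_b ('D_a f) (x + s1 *: a + t1 *: b) =
           'D_a ('D_b f) (x + s2 *: b + t2 *: a).
    have key (A B C D S T : R) : A - B - C + D = S * h * h ->
        A - C - B + D = T * h * h -> S = T.
      move=> e1 e2; have hn0 : h != 0 by rewrite gt_eqF.
      by apply: (mulIf hn0); apply: (mulIf hn0); rewrite -e1 -e2 (addrAC A).
    exact: key E1 E2.
  by apply: dist_half2 B1 _; rewrite E.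
have F1 := near2 _ a b (cont a b); have F2 := near2 _ b a (cont b a).
have F3 : \forall h \near (0 : R)^'+, 0 < h by exact: nbhs_right_gt.
have [h [H1 [H2 H3]]] := filter_ex (filterI F1 (filterI F2 F3)).
by exists h; split; [exact: H3|exact: H1|exact: H2].
Unshelve. all: by end_near. Qed.

End Schwarz.

(** * Bump functions *)

Section Bump.
Context {R : realType}.

(** The member [m = 0] is the classical function exp(-1/t), flat at 0. Powers of 1/t are included
    because the derivative of member [m] combines members [m.+2] and [m.+1]; one induction then
    shows that all members are smooth. *)
Definition flat_exp (m : nat) (t : R) : R :=
  if 0 < t then t^-1 ^+ m * expR (- t^-1) else 0.

Lemma flat_exp_ge0 m t : 0 <= flat_exp m t.
Proof.
rewrite /flat_exp; case: ifP => // t0.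
by rewrite mulr_ge0 ?expR_ge0// exprn_ge0// invr_ge0 ltW.
Qed.

Lemma flat_exp_gt0 m t : 0 < t -> 0 < flat_exp m t.
Proof.
by move=> t0; rewrite /flat_exp t0 mulr_gt0 ?expR_gt0// exprn_gt0// invr_gt0.
Qed.

Lemma flat_exp_le0 m t : t <= 0 -> flat_exp m t = 0.
Proof. by move=> t0; rewrite /flat_exp ltNge t0. Qed.

Lemma flat_exp_le_sqr m t : `|flat_exp m t| <= (m.+2)`!%:R * t ^+ 2.
Proof.
rewrite ger0_norm ?flat_exp_ge0//; have [t0|t0] := ltP 0 t; last first.
  by rewrite flat_exp_le0// mulr_ge0// sqr_ge0.
rewrite /flat_exp t0.
have := @expR_ge1Dxn R t^-1 m.+1 (ltW _); rewrite invr_gt0 t0 => /(_ isT).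
have f0 : 0 < (m.+2)`!%:R :> R by rewrite ltr0n fact_gt0.
move=> H; have {}H : t^-1 ^+ m.+2 / (m.+2)`!%:R <= expR t^-1.
  by apply: le_trans H; rewrite lerDr.
rewrite expRN ler_pdivrMr ?expR_gt0//.
apply: le_trans (ler_wpM2l _ H); last by rewrite mulr_ge0 ?sqr_ge0.
rewrite le_eqVlt; apply/orP; left; apply/eqP.
rewrite !exprS; field.
by rewrite !gt_eqF.
Qed.

Lemma is_derive_sqr_bound (f : R -> R) C : (forall t, `|f t| <= C * t ^+ 2) ->
  is_derive (0 : R) (1 : R) f (0 : R).
Proof.
move=> fC; have f0 : f 0 = 0.
  by apply/eqP; rewrite -normr_le0 (le_trans (fC 0))// expr0n mulr0.
have C0 : 0 <= C by have := fC 1; rewrite expr1n mulr1; apply: le_trans.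
suff H : h^-1 *: (f (h *: (1 : R) + 0) - f 0) @[h --> 0^'] --> (0 : R).
  by split; [apply/cvg_ex; exists 0|exact: cvg_lim H].
have C1 : 0 < C + 1 by rewrite ltr_wpDl.
apply/cvgrPdist_le => e e0; near=> h.
rewrite sub0r normrN f0 subr0 addr0 [h *: 1]mulr1 normrM normfV.
have h0 : 0 < `|h| by rewrite normr_gt0; near: h; exact: nbhs_dnbhs_neq.
rewrite ler_pdivrMl// (le_trans (fC h))// -(real_normK (num_real h)) expr2.
rewrite mulrCA ler_wpM2l//.
have : `|h| <= e / (C + 1).
  by near: h; exact: dnbhs0_le (divr_gt0 e0 C1).
rewrite ler_pdivlMr// mulrDr mulr1 [_ * C]mulrC; apply: le_trans.
by rewrite lerDl.
Unshelve. all: by end_near. Qed.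

Lemma is_derive_flat_exp m (t : R) :
  is_derive t (1 : R) (flat_exp m) (flat_exp m.+2 t - m%:R * flat_exp m.+1 t).
Proof.
have [t0|t0|<-] := ltgtP 0 t; last first.
- rewrite !flat_exp_le0// mulr0 subr0.
  exact: is_derive_sqr_bound (flat_exp_le_sqr m).
- rewrite !flat_exp_le0 ?ltW// mulr0 subr0.
  apply: near_eq_is_derive (is_derive_cst 0 t 1).
  near=> s; rewrite flat_exp_le0// ltW//; near: s.
  exact: open_nbhs_nbhs (conj (@open_lt _ 0) t0).
apply: (@near_eq_is_derive R R R (fun s : R => s^-1 ^+ m * expR (- s^-1))).
  near=> s; rewrite /flat_exp ifT//; near: s.
  exact: open_nbhs_nbhs (conj (@open_gt _ 0) t0).
have tn0 : t != 0 by rewrite gt_eqF.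
have dV : is_derive t (1 : R) (fun s : R => s^-1) (- t ^- 2).
  have := is_deriveV tn0 (is_derive_id t (1 : R)).
  by rewrite [_ *: 1]mulr1.
have dE : is_derive t (1 : R) (fun s : R => expR (- s^-1))
    (expR (- t^-1) * (- - t ^- 2)).
  apply: (@is_derive1_comp _ expR (fun s => - s^-1)); exact: is_deriveN.
have -> : (fun s : R => s^-1 ^+ m * expR (- s^-1)) =
    (fun s : R => s^-1) ^+ m * (fun s : R => expR (- s^-1)).
  by apply/funext => s; rewrite /= exprfctE.
apply: is_derive_eq (is_deriveM (is_deriveX m dV) dE) _.
rewrite /flat_exp t0 exprfctE -exprVn opprK.
case: m => [|m] /=; first by rewrite !expr0 /GRing.scale /=; ring.
by rewrite !exprS /GRing.scale /=; ring.
Unshelve. all: by end_near. Qed.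

Lemma diff_near_flat_exp n k m (g : 'rV[R]_n -> R) x : smooth_at g x ->
  diff_near k (flat_exp m \o g) x.
Proof.
move=> sg; elim: k m => //= k IH m.
have df t : differentiable (flat_exp m) t.
  by apply/derivable1_diffP; case: (is_derive_flat_exp m t).
have dg := smooth_at_near_diff sg; split.
  by near=> y; apply: differentiable_comp => //; near: y.
move=> v; have D : \forall y \near x,
    ((flat_exp m.+2 \o g) y + (- m%:R) * (flat_exp m.+1 \o g) y) * 'D_v g y =
    'D_v (flat_exp m \o g) y.
  near=> y; have dgy : differentiable g y by near: y.
  rewrite [RHS]deriveE; last exact: differentiable_comp.
  rewrite diff_comp//= deriveE// diff1E// derive1E.
  rewrite (@derive_val _ _ _ _ _ _ _ (is_derive_flat_exp m (g y))).
  by rewrite mulNr mulrC.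
apply: diff_near_eq D _; apply: diff_nearM; last exact: smooth_at_derive.
apply: diff_nearD; first exact: IH.
by apply: diff_nearM; [exact: diff_near_cst|exact: IH].
Unshelve. all: by end_near. Qed.

(** A smooth step, 1 up to [b / 2] and 0 from [b] on. For [b > 0] the arguments [b - t] and
    [t - b / 2] are never both nonpositive, so the denominator is positive. *)
Definition cutoff (b t : R) : R :=
  flat_exp 0 (b - t) / (flat_exp 0 (b - t) + flat_exp 0 (t - b / 2)).

Lemma cutoff_den b t : 0 < b -> flat_exp 0 (b - t) + flat_exp 0 (t - b / 2) != 0.
Proof.
move=> b0; rewrite gt_eqF//; have [tb|bt] := ltP t b.
  by rewrite ltr_pwDl ?flat_exp_gt0 ?subr_gt0// flat_exp_ge0.
by rewrite ltr_wpDl ?flat_exp_ge0// flat_exp_gt0//; lra.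
Qed.

Lemma cutoff1 b t : 0 < b -> t <= b / 2 -> cutoff b t = 1.
Proof.
move=> b0 tb; have := cutoff_den t b0; rewrite /cutoff.
by rewrite (@flat_exp_le0 _ (t - b / 2)) ?subr_le0// addr0; exact: divff.
Qed.

Lemma cutoff0 b t : b <= t -> cutoff b t = 0.
Proof. by move=> bt; rewrite /cutoff flat_exp_le0 ?subr_le0// mul0r. Qed.

Lemma smooth_at_cutoff n (g : 'rV[R]_n -> R) b x : 0 < b -> smooth_at g x ->
  smooth_at (fun y => cutoff b (g y)) x.
Proof.
move=> b0 sg.
have s1 : smooth_at (fun y => flat_exp 0 (b - g y)) x.
  move=> k; apply: (@diff_near_flat_exp _ k 0 (fun y => b - g y)).
  by apply: smooth_atB => //; exact: smooth_at_cst.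
have s2 : smooth_at (fun y => flat_exp 0 (g y - b / 2)) x.
  move=> k; apply: (@diff_near_flat_exp _ k 0 (fun y => g y - b / 2)).
  by apply: smooth_atB => //; exact: smooth_at_cst.
apply: smooth_atM => //; apply: smooth_atV; first exact: cutoff_den.
exact: smooth_atD.
Qed.

(** The set [K] is compact, and not merely closed, because its image in the manifold will have to be
    closed. *)
Lemma rV_bump n (z0 : 'rV[R]_n) (U : set 'rV[R]_n) : nbhs z0 U ->
  exists (b : 'rV[R]_n -> R) (K : set 'rV[R]_n),
    [/\ compact K, K `<=` U, forall z, smooth_at b z,
        forall z, ~ K z -> b z = 0 & \forall z \near z0, b z = 1].
Proof.
move=> /nbhs_ballP[e /= e0 eU].
(* The norm of ['rV] is the sup norm, which is not smooth, so the cutoff is applied to the squared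
   Euclidean distance. It dominates every squared coordinate, hence its sublevel set lies in the
   cube of half-width [e / 2], a compact subset of the ball of radius [e]. *)
pose q (z : 'rV[R]_n) := \sum_i (z 0 i - z0 0 i) ^+ 2.
have q_ge0 z : 0 <= q z by apply: sumr_ge0 => i _; exact: sqr_ge0.
have sq z : smooth_at q z.
  apply: smooth_at_sum => i.
  have s1 : smooth_at (fun z : 'rV[R]_n => z 0 i - z0 0 i) z.
    by apply: smooth_atB; [exact: smooth_at_coord|exact: smooth_at_cst].
  by apply: smooth_at_eq (smooth_atM s1 s1); near=> y; rewrite expr2.
have b0 : 0 < (e / 2) ^+ 2 by rewrite exprn_gt0// divr_gt0.
exists (fun z => cutoff ((e / 2) ^+ 2) (q z)).
exists [set z | forall i, z 0 i \in `[z0 0 i - e / 2, z0 0 i + e / 2]]; split.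
- apply: (@rV_compact R n (fun i => [set` `[z0 0 i - e / 2, z0 0 i + e / 2]])).
  by move=> i; exact: segment_compact.
- move=> z Kz; apply: eU; split=> // i j; rewrite ord1 -ball_normE /=.
  have := Kz j; rewrite in_itv /= -ler_distlC => /le_lt_trans; apply.
  by lra.
- by move=> z; exact: smooth_at_cutoff.
- move=> z Kz; apply: cutoff0; rewrite leNgt; apply/negP => qz; apply: Kz => i.
  rewrite in_itv /= -ler_distlC -(@ler_pXn2r _ 2) ?nnegrE//; last by lra.
  apply: le_trans (ltW qz); rewrite real_normK ?num_real//.
  rewrite -[leLHS]sqrrN opprB /q (bigD1 i)//= lerDl.
  by apply: sumr_ge0 => j _; exact: sqr_ge0.
- near=> z; apply: cutoff1 => //; near: z.
  have := smooth_at_cvg (sq z0) => /cvgrPdist_le/(_ ((e / 2) ^+ 2 / 2)).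
  rewrite divr_gt0// => /(_ isT); apply: filterS => z.
  have -> : q z0 = 0 by rewrite /q big1// => i _; rewrite subrr expr0n.
  by rewrite sub0r normrN ger0_norm.
Unshelve. all: by end_near. Qed.

End Bump.

(** * Smooth functions and derivations on a manifold *)

Section ManifoldSmooth.
Context {R : realType} {n : nat} {M : manifold R n}.
Implicit Types (f g : M -> R) (x y : M).

Definition smooth_fun_at f x :=
  forall i, chart_dom i x -> smooth_at (f \o chartV i) (chart i x).

Lemma near_chartV i x (P : M -> Prop) : chart_dom i x ->
  (\forall y \near x, P y) -> \forall z \near chart i x, P (chartV i z).
Proof.
by move=> ix Px; apply: (chartV_continuous ix); rewrite chartK.
Qed.

Lemma near_chart i x (P : 'rV[R]_n -> Prop) : chart_dom i x ->
  (\forall z \near chart i x, P z) -> \forall y \near x, P (chart i y).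
Proof. by move=> ix Px; exact: (chart_continuous ix). Qed.

Lemma near_dom (i : chart_index M) x : chart_dom i x ->
  \forall y \near x, chart_dom i y.
Proof. by move=> ix; apply: open_nbhs_nbhs; split=> //; exact: dom_open. Qed.

Lemma near_chart_image (i : chart_index M) x : chart_dom i x ->
  \forall z \near chart i x, (chart i @` chart_dom i) z.
Proof.
move=> ix; apply: open_nbhs_nbhs; split; first exact: chart_open.
by exists x.
Qed.

Lemma smooth_fun_at_eq f g x : (\forall y \near x, f y = g y) ->
  smooth_fun_at f x -> smooth_fun_at g x.
Proof. by move=> fg sf i ix; apply: smooth_at_eq (near_chartV ix fg) (sf i ix). Qed.

Lemma smooth_fun_at_chart i f x : chart_dom i x ->
  smooth_at (f \o chartV i) (chart i x) -> smooth_fun_at f x.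
Proof.
move=> ix sf j jx.
apply: (@smooth_at_eq _ _ ((f \o chartV i) \o (chart i \o chartV j))).
  near=> z; rewrite /= chartK//; near: z.
  exact: (near_chartV jx (near_dom ix)).
apply: smooth_at_comp; last by rewrite /= chartK.
by move=> k; exact: (chart_transition jx ix k).
Unshelve. all: by end_near. Qed.

Lemma smooth_fun_at_cst c x : smooth_fun_at (fun=> c) x.
Proof. by move=> i ix; exact: smooth_at_cst. Qed.

Lemma smooth_fun_atB f g x : smooth_fun_at f x -> smooth_fun_at g x ->
  smooth_fun_at (fun y => f y - g y) x.
Proof. by move=> sf sg i ix; exact: smooth_atB (sf i ix) (sg i ix). Qed.

Lemma smooth_fun_atM f g x : smooth_fun_at f x -> smooth_fun_at g x ->
  smooth_fun_at (fun y => f y * g y) x.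
Proof. by move=> sf sg i ix; exact: smooth_atM (sf i ix) (sg i ix). Qed.

Lemma smooth_fun_atV f x : f x != 0 -> smooth_fun_at f x ->
  smooth_fun_at (fun y => (f y)^-1) x.
Proof. by move=> f0 sf i ix; apply: smooth_atV (sf i ix); rewrite /= chartK. Qed.

Lemma smooth_fun_at_sum (I : Type) (s : seq I) (P : pred I) (F : I -> M -> R) x :
  (forall i, smooth_fun_at (F i) x) ->
  smooth_fun_at (fun y => \sum_(i <- s | P i) F i y) x.
Proof.
move=> sF i ix.
by apply: (@smooth_at_sum _ _ _ s P (fun k => F k \o chartV i)) => k; exact: sF.
Qed.

Lemma smooth_fun_at_prod (I : Type) (s : seq I) (P : pred I) (F : I -> M -> R) x :
  (forall i, smooth_fun_at (F i) x) ->
  smooth_fun_at (fun y => \prod_(i <- s | P i) F i y) x.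
Proof.
move=> sF i ix.
by apply: (@smooth_at_prod _ _ _ s P (fun k => F k \o chartV i)) => k; exact: sF.
Qed.

Lemma Cinf_at (f : Cinf M) x : smooth_fun_at f x.
Proof. by move=> i ix; exact: CinfP. Qed.

Lemma smooth_fun_cvg f x : smooth_fun_at f x -> {for x, continuous f}.
Proof.
move=> sf; have [i ix] := dom_cover x.
have cf := smooth_at_cvg (sf i ix).
have : {for x, continuous ((f \o chartV i) \o chart i)}.
  by apply: continuous_comp cf; exact: chart_continuous.
rewrite /prop_for /continuous_at [in X in X -> _]/= chartK// => H.
apply: cvg_trans H; apply: near_eq_cvg.
by near=> y; rewrite /= chartK//; near: y; exact: near_dom.
Unshelve. all: by end_near. Qed.

(** The second conclusion stands for support inside [U]. It is the case distinction that shows that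
    [c] times something defined and smooth on [U] is smooth everywhere. *)
Lemma bump_exists x (U : set M) : nbhs x U ->
  exists c : Cinf M, (\forall y \near x, c y = 1) /\
    forall y, U y \/ \forall z \near y, c z = 0.
Proof.
move=> xU; have [i ix] := dom_cover x.
have U' : nbhs (chart i x)
    [set z | U (chartV i z) /\ (chart i @` chart_dom i) z].
  apply: filterI; last exact: near_chart_image.
  exact: (near_chartV ix xU).
have [b [K [cK KU sb b0 b1]]] := rV_bump U'.
pose c y := if `[< chart_dom i y >] then b (chart i y) else 0.
(* In a Hausdorff space the compact image is closed; so [c] vanishes near, and not only at, each
   point outside it. *)
have cC : closed (chartV i @` K).
  apply: compact_closed; first exact: manifold_hausdorff.
  apply: continuous_compact => //; apply: continuous_in_subspaceT => z /set_mem/KU.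
  by move=> [_ [y iy <-]]; exact: chartV_continuous.
have c0 y : ~ (chartV i @` K) y -> c y = 0.
  move=> nCy; rewrite /c; case: asboolP => // iy; apply: b0 => Ky.
  by apply: nCy; exists (chart i y) => //; exact: chartK.
have c0n y : ~ (chartV i @` K) y -> \forall z \near y, c z = 0.
  move=> nCy; have : nbhs y (~` (chartV i @` K)).
    by apply: open_nbhs_nbhs; split=> //; exact: closed_openC.
  by apply: filterS => z; exact: c0.
have sc : smooth_fun c.
  suff sc y : smooth_fun_at c y by move=> j y jy; exact: sc.
  have [Cy|/c0n] := pselect ((chartV i @` K) y); last first.
    move=> cy0; apply: (@smooth_fun_at_eq (fun=> 0)); last exact: smooth_fun_at_cst.
    by apply: filterS cy0 => z ->.
  have iy : chart_dom i y.
    by case: Cy => z /KU[_ [w iw <-]] <-; rewrite chartK.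
  apply: (smooth_fun_at_chart iy); apply: smooth_at_eq (sb (chart i y)).
  near=> z; rewrite /= /c.
  have [w iw <-] : (chart i @` chart_dom i) z by near: z; exact: near_chart_image.
  by rewrite chartK//; case: asboolP.
exists (MkCinf sc); split.
  near=> y; rewrite /= /c asboolT; last by near: y; exact: near_dom.
  by near: y; exact: (near_chart ix b1).
move=> y; have [Cy|nCy] := pselect ((chartV i @` K) y).
  by left; case: Cy => z /KU[Uz _] <-.
by right; exact: c0n.
Unshelve. all: by end_near. Qed.

Lemma bump_smooth (c : Cinf M) (U : set M) f :
  (forall y, U y \/ \forall z \near y, c z = 0) ->
  (forall y, U y -> smooth_fun_at f y) -> smooth_fun (fun y => c y * f y).
Proof.
move=> cU sf; suff H y : smooth_fun_at (fun y => c y * f y) y by move=> j y jy; exact: H.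
have [Uy|c0] := cU y; first by apply: smooth_fun_atM (sf y Uy); exact: Cinf_at.
apply: (@smooth_fun_at_eq (fun=> 0)); last exact: smooth_fun_at_cst.
by apply: filterS c0 => z ->; rewrite mul0r.
Qed.

Lemma extend_smooth f x : (\forall y \near x, smooth_fun_at f y) ->
  exists g : Cinf M, \forall y \near x, g y = f y.
Proof.
move=> sf; have [c [c1 cU]] := bump_exists sf.
exists (MkCinf (bump_smooth cU (fun y => id))).
by apply: filterS c1 => y /= ->; rewrite mul1r.
Qed.

End ManifoldSmooth.

(** * Tangent vectors as derivations, and the bracket of vector fields *)

Section Derivations.
Context {R : realType} {n : nat} {M : manifold R n}.
Implicit Types (f g : Cinf M) (x y : M).

Lemma Cinf_eq f g : (forall x, f x = g x) -> f = g.
Proof.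
case: f g => [f Pf] [g Pg] /= /funext fg; subst g.
by congr MkCinf; exact: Prop_irrelevance.
Qed.

Definition Cinf_mul f g : Cinf M := MkCinf (CinfM_smooth f g).

Lemma tangent_eq x (v w : tangent x) : (forall f, v f = w f) -> v = w.
Proof. by move=> vw; apply: val_inj; apply/funext. Qed.

Lemma tangent_combE x (c : R) (v w : tangent x) f :
  (c *: v + w) f = c * v f + w f.
Proof. by []. Qed.

Lemma tangent_chart x (v : tangent x) i : chart_dom i x ->
  exists w : 'rV[R]_n, forall f, v f = 'D_w (f \o chartV i) (chart i x).
Proof. by move=> ix; case: v => v /= /asboolP; exact. Qed.

Lemma Cinf_chart_diff f i x : chart_dom i x ->
  differentiable (f \o chartV i) (chart i x).
Proof. by move=> ix; apply: smooth_at_diff; exact: CinfP. Qed.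

Lemma tangentM x (v : tangent x) f g :
  v (Cinf_mul f g) = f x * v g + g x * v f.
Proof.
have [i ix] := dom_cover x; have [w vw] := tangent_chart v ix.
rewrite !vw (_ : Cinf_mul f g \o _ = (f \o chartV i) * (g \o chartV i))//.
have df (h : Cinf M) : derivable (h \o chartV i) (chart i x) w.
  by apply/diff_derivable/(Cinf_chart_diff h).
by rewrite deriveM//= chartK.
Qed.

Lemma tangent_near x (v : tangent x) f g : (\forall y \near x, f y = g y) ->
  v f = v g.
Proof.
move=> fg; have [i ix] := dom_cover x; have [w vw] := tangent_chart v ix.
by rewrite !vw; apply: near_eq_derive; exact: (near_chartV ix fg).
Qed.

Lemma tangent_cst x (v : tangent x) f (c : R) : (\forall y \near x, f y = c) ->
  v f = 0.
Proof.
move=> fc; rewrite (tangent_near v (g := Cinf_cst c))//.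
have [i ix] := dom_cover x; have [w vw] := tangent_chart v ix.
by rewrite vw; exact: derive_cst.
Qed.

Lemma transition_derive (f : M -> R) i j x w : chart_dom i x -> chart_dom j x ->
    smooth_fun_at f x ->
  'D_w (f \o chartV i) (chart i x) =
  'D_('D_w (chart j \o chartV i) (chart i x)) (f \o chartV j) (chart j x).
Proof.
move=> ix jx sf.
have E : \forall z \near chart i x,
    (f \o chartV i) z = ((f \o chartV j) \o (chart j \o chartV i)) z.
  near=> z; rewrite /= chartK//; near: z.
  exact: (near_chartV ix (near_dom jx)).
rewrite (near_eq_derive _ E) derive_rV_comp /=.
- by rewrite chartK.
- by rewrite chartK//; exact: smooth_at_diff (sf j jx).
- apply: differentiable_rV => k; apply: smooth_at_diff.
  exact: (chart_transition ix jx k).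
Unshelve. all: by end_near. Qed.

Lemma coord_is_tangent i x (w : 'rV[R]_n) : chart_dom i x ->
  is_tangent x (fun f => 'D_w (f \o chartV i) (chart i x)).
Proof.
move=> ix; apply/asboolP => j jx.
exists ('D_w (chart j \o chartV i) (chart i x)) => f.
by apply: transition_derive => //; exact: Cinf_at.
Qed.

Lemma tangent_lin x (v : tangent x) (c : R) f g (h : Cinf M) :
  (forall y, h y = c * f y + g y) -> v h = c * v f + v g.
Proof.
move=> hE; have [i ix] := dom_cover x; have [w vw] := tangent_chart v ix.
have E1 : h \o chartV i = c *: (f \o chartV i) + (g \o chartV i).
  by apply/funext => z; exact: hE.
have dd (u : Cinf M) : derivable (u \o chartV i) (chart i x) w.
  by apply: diff_derivable; exact: (Cinf_chart_diff u).
by rewrite !vw E1 deriveD ?deriveZ//; exact: derivableZ.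
Qed.

(** Tangent vectors act on global functions only. The [X k] are global functions that agree with the
    chart coordinates near [x], so that [u y (X k)] is the [k]-th component of a tangent vector
    [u y]. *)
Lemma chart_coords i x : chart_dom i x ->
  exists X : 'I_n -> Cinf M, \forall y \near x, forall k (a : 'rV[R]_n),
    'D_a (X k \o chartV i) (chart i y) = a 0 k.
Proof.
move=> ix.
have coordE k : exists X : Cinf M, \forall y \near x, X y = chart i y 0 k.
  apply: extend_smooth; apply: filterS (near_dom ix) => y iy.
  apply: (smooth_fun_at_chart iy); apply: smooth_at_eq (smooth_at_coord k _).
  near=> z; have [u iu <-] : (chart i @` chart_dom i) z.
    by near: z; exact: near_chart_image.
  by rewrite /= chartK.
have [X XE] := choice coordE.
have nearX : \forall y \near x, \forall z \near y, forall k, X k z = chart i z 0 k.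
  exact: nbhs_interior (filter_forall _ XE).
exists X; near=> y => k a.
have iy : chart_dom i y by near: y; exact: near_dom.
have H : \forall z \near y, forall k, X k z = chart i z 0 k by near: y.
rewrite -(derive_coord k (chart i y) a); apply: near_eq_derive; near=> z.
have Hz : forall k, X k (chartV i z) = chart i (chartV i z) 0 k.
  by near: z; exact: near_chartV iy H.
have [q iq qz] : (chart i @` chart_dom i) z.
  by near: z; exact: near_chart_image.
by rewrite /= Hz -qz chartK.
Unshelve. all: by end_near. Qed.

(** In coordinates [v (w f)] is a second derivative of [f] plus a first-order part. The second
    derivatives cancel by symmetry, and what remains differentiates [f] along the vector with
    components [v (w (X k)) - w (v (X k))]. *)
Lemma bracket_is_tangent (v w : sec (TM M)) x :
  is_tangent x (fun f => v x (vderiv w f) - w x (vderiv v f)).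
Proof.
apply/asboolP => i ix; set p := chart i x.
have [X coordD] := chart_coords ix.
have comp (u : sec (TM M)) f : \forall y \near x,
    u y f = \sum_k u y (X k) * 'D_(delta_mx 0 k) (f \o chartV i) (chart i y).
  near=> y; have iy : chart_dom i y by near: y; exact: near_dom.
  have [a ua] := tangent_chart (u y) iy.
  rewrite ua derive_dir_sum; last exact: Cinf_chart_diff.
  apply: eq_bigr => k _; congr (_ * _); rewrite ua.
  by apply/esym; move: k a {ua}; near: y.
have dd (u u' : sec (TM M)) (a b : 'rV[R]_n) :
    (forall f, u x f = 'D_a (f \o chartV i) p) ->
    (forall f, u' x f = 'D_b (f \o chartV i) p) -> forall f,
    u x (vderiv u' f) = 'D_b ('D_a (f \o chartV i)) p +
      \sum_k 'D_a (vderiv u' (X k) \o chartV i) p * 'D_(delta_mx 0 k) (f \o chartV i) p.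
  move=> ua ub f; rewrite ua.
  have sF : smooth_at (f \o chartV i) p by exact: CinfP.
  pose G k z := (vderiv u' (X k) \o chartV i) z * 'D_(delta_mx 0 k) (f \o chartV i) z.
  have E : \forall z \near p, (vderiv u' f \o chartV i) z = (\sum_k G k) z.
    near=> z; have [q iq qz] : (chart i @` chart_dom i) z.
      by near: z; exact: near_chart_image.
    have Hz : u' (chartV i z) f = \sum_k u' (chartV i z) (X k) *
        'D_(delta_mx 0 k) (f \o chartV i) (chart i (chartV i z)).
      by near: z; exact: (near_chartV ix (comp u' f)).
    by rewrite fct_sumE /G /= Hz -qz chartK.
  have dG k : derivable (G k) p a.
    apply: diff_derivable; apply: smooth_at_diff; apply: smooth_atM.
      exact: CinfP.
    exact: smooth_at_derive.
  rewrite (near_eq_derive _ E) derive_sum//.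
  rewrite [X in _ = X + _]derive_dir_sum; last first.
    by apply: smooth_at_diff; exact: smooth_at_derive.
  rewrite -big_split /=; apply: eq_bigr => k _.
  rewrite deriveM; last 2 first.
  - by apply: diff_derivable; apply: smooth_at_diff; exact: CinfP.
  - by apply: diff_derivable; apply: smooth_at_diff; exact: smooth_at_derive.
  rewrite (derive_comm a (delta_mx 0 k) sF) /= chartK//; congr (_ * _ + _); last exact: mulrC.
  by rewrite ub; exact: (nbhs_singleton coordD).
have [a va] := tangent_chart (v x) ix; have [b wb] := tangent_chart (w x) ix.
exists (\row_k ('D_a (vderiv w (X k) \o chartV i) p -
                'D_b (vderiv v (X k) \o chartV i) p)) => f.
have sF : smooth_at (f \o chartV i) p by exact: CinfP.
rewrite (dd v w a b va wb) (dd w v b a wb va) (derive_comm _ _ sF).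
rewrite opprD addrACA subrr add0r -sumrB derive_dir_sum; last exact: smooth_at_diff.
by apply: eq_bigr => k _; rewrite mxE mulrBl.
Unshelve. all: by end_near. Qed.

End Derivations.

(** * Vector fields and gauge operators *)

Section VectorFields.
Context {R : realType} {n : nat} {M : manifold R n}.

Lemma insub_tangentE x (d : Cinf M -> R^o) f : is_tangent x d ->
  (insubd (0 : tangent x) d) f = d f.
Proof. by move=> dP; rewrite -[LHS]/(val (insubd (0 : tangent x) d) f) insubdK. Qed.

Lemma extend_vfield (v : forall x : M, tangent x) (x0 : M) :
  (\forall y \near x0, forall f, smooth_fun_at (fun z => v z f) y) ->
  exists w : sec (TM M), \forall y \near x0, w y = v y.
Proof.
move=> sv; have [c [c1 cU]] := bump_exists sv.
have sw : TM_smooth (fun y => c y *: v y).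
  by move=> f; exact: (bump_smooth (f := fun y => v y f) cU (fun y vy => vy f)).
exists (Sec (sw : smooth_sec (b := TM M) _)).
by apply: filterS c1 => y /= ->; rewrite scale1r.
Qed.

Lemma coord_vfield i x0 (w : 'rV[R]_n) : chart_dom i x0 ->
  exists v : sec (TM M), \forall y \near x0, forall f : Cinf M,
    v y f = 'D_w (f \o chartV i) (chart i y).
Proof.
move=> ix; pose u y : tangent y :=
  insubd 0 (fun f : Cinf M => 'D_w (f \o chartV i) (chart i y)).
have uE y (f : Cinf M) : chart_dom i y -> u y f = 'D_w (f \o chartV i) (chart i y).
  by move=> iy; rewrite insub_tangentE//; exact: coord_is_tangent.
have [|v vu] := @extend_vfield u x0.
  apply: filterS (near_dom ix) => y iy f; apply: (smooth_fun_at_chart iy).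
  apply: smooth_at_eq (smooth_at_derive w (CinfP f iy)); near=> z.
  have [q iq <-] : (chart i @` chart_dom i) z by near: z; exact: near_chart_image.
  by rewrite /= chartK// uE.
exists v; near=> y; rewrite (_ : v y = u y); last by near: y.
by move=> f; apply: uE; near: y; exact: near_dom.
Unshelve. all: by end_near. Qed.

Lemma vfield_through x (t : tangent x) : exists v : sec (TM M), v x = t.
Proof.
have [i ix] := dom_cover x; have [w tw] := tangent_chart t ix.
have [v vE] := coord_vfield w ix; exists v; apply: tangent_eq => f.
by rewrite tw; exact: (nbhs_singleton vE).
Qed.

Lemma vbracket_smooth (v w : sec (TM M)) : TM_smooth (fun x =>
  insubd (0 : tangent x) (fun f : Cinf M => v x (vderiv w f) - w x (vderiv v f))).
Proof.
move=> f i x ix; have : smooth_fun_at (fun y => v y (vderiv w f) - w y (vderiv v f)) x.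
  by apply: smooth_fun_atB;
    [exact: (Cinf_at (vderiv v (vderiv w f)))|
     exact: (Cinf_at (vderiv w (vderiv v f)))].
move=> H; apply: smooth_at_eq (H i ix); near=> z => /=.
by rewrite insub_tangentE//; exact: bracket_is_tangent.
Unshelve. all: by end_near. Qed.

Definition vbracket (v w : sec (TM M)) : sec (TM M) :=
  Sec (vbracket_smooth v w : smooth_sec (b := TM M) _).

Lemma vbracketE (v w : sec (TM M)) x (f : Cinf M) :
  vbracket v w x f = v x (vderiv w f) - w x (vderiv v f).
Proof. by rewrite insub_tangentE//; exact: bracket_is_tangent. Qed.

End VectorFields.

Lemma mksecE (R : realType) n (M : manifold R n) (V : bundle M)
  (s : forall x, V x) x : smooth_sec s -> mksec s x = s x.
Proof. by rewrite /mksec => Ps; case: pselect. Qed.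

(** * Gauge operators: locality, symbols, commutators *)

Section GaugeTheory.
Context {R : realType} {n : nat} {M : manifold R n} {V : bundle M}.
Implicit Types (x : M) (u : sec V).

Lemma gauge_linear x (d : gauge_at V x) c u u' : d (c *: u + u') = c *: d u + d u'.
Proof. by case: d => d /= /asboolP[]. Qed.

Lemma gauge0 x (d : gauge_at V x) : d 0 = 0.
Proof. by have := gauge_linear d (-1) 0 0; rewrite scaler0 addr0 scaleN1r addNr. Qed.

Lemma gaugeD x (d : gauge_at V x) u u' : d (u + u') = d u + d u'.
Proof. by have := gauge_linear d 1 u u'; rewrite !scale1r. Qed.

Lemma gaugeZ x (d : gauge_at V x) c u : d (c *: u) = c *: d u.
Proof. by have := gauge_linear d c u 0; rewrite gauge0 !addr0. Qed.

Lemma gaugeB x (d : gauge_at V x) u u' : d (u - u') = d u - d u'.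
Proof. by rewrite gaugeD -scaleN1r gaugeZ scaleN1r. Qed.

Lemma gauge_sum x (d : gauge_at V x) (I : Type) (s : seq I) (F : I -> sec V) :
  d (\sum_(i <- s) F i) = \sum_(i <- s) d (F i).
Proof.
elim: s => [|i s IH]; first by rewrite !big_nil gauge0.
by rewrite !big_cons gaugeD IH.
Qed.

Lemma sec_sumE (I : Type) (s : seq I) (F : I -> sec V) x :
  (\sum_(i <- s) F i) x = \sum_(i <- s) F i x.
Proof. by elim: s => [|i s IH]; rewrite ?big_nil// !big_cons -IH. Qed.

Lemma gauge_symbol x (d : gauge_at V x) : exists v, has_symbol d v.
Proof. by case: d => d /= /asboolP[]. Qed.

(** Take [c] equal to 1 near [x] with [fmul c u = fmul c u']. The symbol kills [c], so the Leibniz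
    rule reduces [d (fmul c u)] to [d u]. *)
Lemma gauge_near x (d : gauge_at V x) u u' : (\forall y \near x, u y = u' y) ->
  d u = d u'.
Proof.
move=> uu'; have [c [c1 cU]] := bump_exists uu'.
have [v dv] := gauge_symbol d.
have E : fmul c u = fmul c u'.
  apply: sec_eq => y /=; have [->//|/nbhs_singleton->] := cU y.
  by rewrite !scale0r.
have vc : v c = 0 := tangent_cst v c1.
have := congr1 d E; rewrite !dv vc !scale0r !addr0 (nbhs_singleton c1).
by rewrite !scale1r.
Qed.

Lemma gauge_eq x (d d' : gauge_at V x) : (forall u, d u = d' u) -> d = d'.
Proof. by move=> dd'; apply: val_inj; apply/funext. Qed.

(** A smooth vector field of symbols, taken from the smoothness of [d]. The pointwise choice
    [anchor] agrees with it on a vector bundle of positive rank, by [anchorE]. *)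
Definition symb (d : sec (gauge_bundle V)) : sec (TM M) := projT1 (cid (secP d).2).

Lemma symbP (d : sec (gauge_bundle V)) x : has_symbol (d x) (symb d x).
Proof. exact: (projT2 (cid (secP d).2)). Qed.

Lemma insub_gaugeE x (d : sec V -> V x) u : is_gauge d ->
  (insubd (0 : gauge_at V x) d) u = d u.
Proof. by move=> dP; rewrite -[LHS]/(val (insubd (0 : gauge_at V x) d) u) insubdK. Qed.

Lemma gauge_comm_is_gauge (d r : sec (gauge_bundle V)) x :
  (forall (c : R) u u',
    d x (gauge_act r (c *: u + u')) - r x (gauge_act d (c *: u + u')) =
    c *: (d x (gauge_act r u) - r x (gauge_act d u)) +
    (d x (gauge_act r u') - r x (gauge_act d u'))) /\
  has_symbol (fun u => d x (gauge_act r u) - r x (gauge_act d u))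
    (vbracket (symb d) (symb r) x).
Proof.
have lin (e : sec (gauge_bundle V)) c u u' :
    gauge_act e (c *: u + u') = c *: gauge_act e u + gauge_act e u'.
  by apply: sec_eq => y /=; rewrite gauge_linear.
have leib (e : sec (gauge_bundle V)) f u :
    gauge_act e (fmul f u) = fmul f (gauge_act e u) + fmul (vderiv (symb e) f) u.
  by apply: sec_eq => y /=; rewrite symbP.
split=> [c u u'|f u].
  by rewrite !lin !gauge_linear scalerBr opprD addrACA.
rewrite !leib !gaugeD !symbP vbracketE scalerBr scalerBl /=.
(* [B] and [C] are the cross terms, in which one operator differentiates [f] and the other [u]; both
   compositions contain them. *)
have AC (W : zmodType) (A B C D A' D' : W) :
    A + B + (C + D) - (A' + C + (B + D')) = A - A' + (D - D').
  rewrite [A' + C + _]addrACA (opprD (A' + B)) addrACA.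
  rewrite (opprD A') [A + B + _]addrACA subrr addr0.
  by rewrite (opprD C) [C + D + _]addrACA subrr add0r.
by rewrite AC.
Qed.

Lemma gauge_comm_smooth (d r : sec (gauge_bundle V)) :
  gauge_smooth (fun x => insubd (0 : gauge_at V x)
    (fun u => d x (gauge_act r u) - r x (gauge_act d u))).
Proof.
have E x u : (insubd (0 : gauge_at V x)
    (fun u => d x (gauge_act r u) - r x (gauge_act d u))) u =
    d x (gauge_act r u) - r x (gauge_act d u).
  rewrite insub_gaugeE//.
  apply/asboolP; have [H1 H2] := gauge_comm_is_gauge d r x; split=> //.
  by exists (vbracket (symb d) (symb r) x).
split=> [u|].
  have -> : (fun x => (insubd (0 : gauge_at V x)
    (fun u => d x (gauge_act r u) - r x (gauge_act d u))) u) =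
    (gauge_act d (gauge_act r u) - gauge_act r (gauge_act d u) : sec V).
    by apply: functional_extensionality_dep => x; rewrite E /= scaleN1r.
  exact: secP.
exists (vbracket (symb d) (symb r)) => x f u; rewrite !E.
by have [_] := gauge_comm_is_gauge d r x; apply.
Qed.

Lemma gauge_commE (d r : sec (gauge_bundle V)) x u :
  gauge_comm d r x u = d x (gauge_act r u) - r x (gauge_act d u).
Proof.
rewrite /gauge_comm (mksecE (V := gauge_bundle V))//; last exact: gauge_comm_smooth.
rewrite insub_gaugeE//.
apply/asboolP; have [H1 H2] := gauge_comm_is_gauge d r x; split=> //.
by exists (vbracket (symb d) (symb r) x).
Qed.

Lemma gauge_comm_symbol (d r : sec (gauge_bundle V)) x :
  has_symbol (gauge_comm d r x) (vbracket (symb d) (symb r) x).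
Proof.
by move=> f u; rewrite !gauge_commE; have [_] := gauge_comm_is_gauge d r x; apply.
Qed.

Lemma id_gauge_at_is_gauge x : is_gauge (fun u : sec V => u x).
Proof.
apply/asboolP; split=> //; exists 0 => f u.
by rewrite /= scale0r addr0.
Qed.

Lemma id_gauge_smooth : gauge_smooth (fun x => GaugeAt (id_gauge_at_is_gauge x)).
Proof.
split=> [u|]; first exact: secP.
by exists 0 => x f u /=; rewrite scale0r addr0.
Qed.

(** Pairing with the identity operator is the projection [jet_proj], so facts about [jet_proj] are
    instances of facts about [pairing]. *)
Definition id_gauge : sec (gauge_bundle V) :=
  Sec (id_gauge_smooth : smooth_sec (b := gauge_bundle V) _).

End GaugeTheory.

(** * Sections, gauge operators and jets of a vector bundle *)

Section VectorBundleTheory.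
Context {R : realType} {n : nat} {M : manifold R n} {r : nat}
  (E : vector_bundle M r).
Implicit Types (x y : M) (u : sec E).

Definition vb_smooth_at (s : forall x, vfib E x) x := forall i, triv_dom i x ->
  forall k, smooth_fun_at (fun y => triv i y (s y) 0 k) x.

Lemma vb_smoothP (s : forall x, vfib E x) :
  (forall x, vb_smooth_at s x) <-> vb_smooth s.
Proof.
split=> [ss i j x ix jx k|ss x i ix k j jx]; first exact: (ss x i ix k j jx).
exact: ss.
Qed.

Lemma sec_smooth_at u x : vb_smooth_at u x.
Proof. by move: x; apply/vb_smoothP; exact: (secP u). Qed.

Lemma near_triv_dom (i : triv_index E) x : triv_dom i x ->
  \forall y \near x, triv_dom i y.
Proof. by move=> ix; apply: open_nbhs_nbhs; split=> //; exact: triv_dom_open. Qed.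

Lemma vb_smooth_at_eq (s t : forall x, vfib E x) x :
  (\forall y \near x, s y = t y) -> vb_smooth_at s x -> vb_smooth_at t x.
Proof.
move=> st ss i ix k; apply: smooth_fun_at_eq (ss i ix k).
by apply: filterS st => y ->.
Qed.

Lemma triv_inj (i : triv_index E) x : triv_dom i x -> injective (triv i x).
Proof. by move=> ix; exact: can_inj (trivK ix). Qed.

Lemma triv_expand (i : triv_index E) x (v : vfib E x) : triv_dom i x ->
  v = \sum_k triv i x v 0 k *: trivV i x (delta_mx 0 k).
Proof.
move=> ix; apply: (triv_inj ix); rewrite linear_sum [LHS]row_sum_delta.
by apply: eq_bigr => k _; rewrite linearZ /= trivVK.
Qed.

Lemma vb_smooth_at_triv i (s : forall x, vfib E x) x : triv_dom i x ->
  (forall k, smooth_fun_at (fun y => triv i y (s y) 0 k) x) -> vb_smooth_at s x.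
Proof.
move=> ix ss j jx k.
apply: (@smooth_fun_at_eq _ _ _ (fun y => \sum_l triv i y (s y) 0 l *
    triv j y (trivV i y (delta_mx 0 l)) 0 k)).
  near=> y; rewrite {2}(@triv_expand i y (s y)); last first.
    by near: y; exact: near_triv_dom.
  by rewrite linear_sum summxE; apply: eq_bigr => l _; rewrite linearZ mxE.
apply: smooth_fun_at_sum => l; apply: smooth_fun_atM => // p px.
exact: (triv_transition ix jx px).
Unshelve. all: by end_near. Qed.

Lemma bump_vb_smooth (c : Cinf M) (U : set M) (s : forall x, vfib E x) :
  (forall y, U y \/ \forall z \near y, c z = 0) ->
  (forall y, U y -> vb_smooth_at s y) -> vb_smooth (fun y => c y *: s y).
Proof.
move=> cU ss; apply/vb_smoothP => y i iy k.
have [Uy|c0] := cU y.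
  apply: (@smooth_fun_at_eq _ _ _ (fun y => c y * triv i y (s y) 0 k)).
    by near=> z; rewrite linearZ mxE.
  by apply: smooth_fun_atM; [exact: Cinf_at|exact: ss].
apply: (@smooth_fun_at_eq _ _ _ (fun=> 0)); last exact: smooth_fun_at_cst.
by apply: filterS c0 => z ->; rewrite scale0r linear0 mxE.
Unshelve. all: by end_near. Qed.

Lemma extend_sec (s : forall x, vfib E x) x0 :
  (\forall y \near x0, vb_smooth_at s y) ->
  exists t : sec E, \forall y \near x0, t y = s y.
Proof.
move=> ss; have [c [c1 cU]] := bump_exists ss.
exists (Sec (bump_vb_smooth cU (fun y => id) : smooth_sec (b := E) _)).
by apply: filterS c1 => y /= ->; rewrite scale1r.
Qed.

Lemma local_frame (i : triv_index E) x0 : triv_dom i x0 ->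
  exists e : 'I_r -> sec E, \forall y \near x0,
    triv_dom i y /\ forall k, e k y = trivV i y (delta_mx 0 k).
Proof.
move=> ix; have ext k : exists t : sec E, \forall y \near x0,
    t y = trivV i y (delta_mx 0 k).
  apply: extend_sec; apply: filterS (near_triv_dom ix) => y iy.
  apply: (vb_smooth_at_triv iy) => l.
  apply: (@smooth_fun_at_eq _ _ _ (fun=> (delta_mx 0 k : 'rV[R]_r) 0 l));
    last exact: smooth_fun_at_cst.
  by apply: filterS (near_triv_dom iy) => z iz; rewrite trivVK.
have [e eE] := choice ext; exists e.
exact: filterI (near_triv_dom ix) (filter_forall _ eE).
Qed.

Lemma local_coef (i : triv_index E) x0 u : triv_dom i x0 ->
  exists c : 'I_r -> Cinf M, \forall y \near x0,
    forall k, c k y = triv i y (u y) 0 k.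
Proof.
move=> ix; have ext k : exists c : Cinf M, \forall y \near x0,
    c y = triv i y (u y) 0 k.
  apply: extend_smooth; apply: filterS (near_triv_dom ix) => y iy.
  exact: sec_smooth_at.
by have [c cE] := choice ext; exists c; exact: (filter_forall _ cE).
Qed.

(* Near [x] the section [u] is the combination of the [e k] with coefficients [c k]. *)
Lemma gauge_expand (i : triv_index E) x (e : 'I_r -> sec E) (c : 'I_r -> Cinf M)
    (d : gauge_at E x) v u :
  (\forall y \near x, triv_dom i y /\ forall k, e k y = trivV i y (delta_mx 0 k)) ->
  (\forall y \near x, forall k, c k y = triv i y (u y) 0 k) ->
  has_symbol d v ->
  d u = \sum_k (triv i x (u x) 0 k *: d (e k) + v (c k) *: e k x).
Proof.
move=> eE cE dv; have -> : d u = d (\sum_k fmul (c k) (e k)).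
  apply: gauge_near; near=> y; rewrite sec_sumE.
  have [iy ey] : triv_dom i y /\ forall k, e k y = trivV i y (delta_mx 0 k) by near: y.
  rewrite [LHS](triv_expand _ iy); apply: eq_bigr => k _ /=.
  by rewrite ey; congr (_ *: _); apply/esym; move: k; near: y.
rewrite gauge_sum; apply: eq_bigr => k _.
by rewrite dv (nbhs_singleton cE).
Unshelve. all: by end_near. Qed.

(** An operator with zero symbol is linear over smooth functions, so only the value of [u] at [x]
    matters. *)
Lemma gauge_symbol0 x (d : gauge_at E x) u : has_symbol d 0 -> u x = 0 -> d u = 0.
Proof.
move=> d0 ux; have [i ix] := triv_cover E x.
have [e eE] := local_frame ix; have [c cE] := local_coef u ix.
rewrite (gauge_expand eE cE d0) big1// => k _.
by rewrite ux linear0 mxE !scale0r addr0.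
Qed.

(** Gauge operators are of first order; this makes [pairing] independent of the representative of a
    jet. *)
Lemma gauge_vanish1 x (d : gauge_at E x) u : vanish1 x u -> d u = 0.
Proof.
move=> /asboolP v1; have [i ix] := triv_cover E x; have [j jx] := dom_cover x.
have [e eE] := local_frame ix; have [c cE] := local_coef u ix.
have [v dv] := gauge_symbol d; have [w vw] := tangent_chart v jx.
rewrite (gauge_expand eE cE dv) big1// => k _.
have [c0 cw] := v1 i j ix jx k.
move: c0; rewrite /coef chartK// => ->; rewrite scale0r add0r vw.
rewrite (near_eq_derive _ (g := coef u i j k)) ?cw ?scale0r//.
by apply: filterS (near_chartV jx cE) => z /(_ k).
Qed.

Lemma jet_reprB x u : vanish1 x (repr (jet x u) - u).
Proof. by apply/jet_eq; rewrite jet_repr. Qed.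

Lemma pairing_jet x u (d : gauge_at E x) : pairing (jet x u) d = d u.
Proof.
apply/eqP; rewrite -subr_eq0 /pairing -gaugeB; apply/eqP.
exact: gauge_vanish1 (jet_reprB x u).
Qed.

Lemma jet_proj_jet x u : jet_proj (jet x u) = u x.
Proof. exact: (pairing_jet u (id_gauge x)). Qed.

Lemma pairing_linear x (d : gauge_at E x) c m m' :
  pairing (c *: m + m') d = c *: pairing m d + pairing m' d.
Proof.
rewrite -[m]jet_repr -[m']jet_repr (_ : c *: jet x (repr m) = jet x (c *: repr m)).
  by rewrite -jetD !pairing_jet gaugeD gaugeZ.
by rewrite jetZ.
Qed.

Lemma pairing0 x (d : gauge_at E x) : pairing 0 d = 0.
Proof. by have := pairing_linear d (-1) 0 0; rewrite scaler0 addr0 scaleN1r addNr. Qed.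

Lemma pairingD x (d : gauge_at E x) m m' :
  pairing (m + m') d = pairing m d + pairing m' d.
Proof. by have := pairing_linear d 1 m m'; rewrite !scale1r. Qed.

Lemma pairingZ x (d : gauge_at E x) c m : pairing (c *: m) d = c *: pairing m d.
Proof. by have := pairing_linear d c m 0; rewrite pairing0 !addr0. Qed.

Lemma pairingB x (d : gauge_at E x) (m m' : jet_at E x) :
  pairing (m - m') d = pairing m d - pairing m' d.
Proof.
by have := pairing_linear d (-1) m' m; rewrite !scaleN1r ![- _ + _]addrC.
Qed.

Lemma pairing_sum x (d : gauge_at E x) (I : Type) (s : seq I) (F : I -> jet_at E x) :
  pairing (\sum_(i <- s) F i) d = \sum_(i <- s) pairing (F i) d.
Proof.
elim: s => [|i s IH]; first by rewrite !big_nil pairing0.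
by rewrite !big_cons pairingD IH.
Qed.

Lemma pairing_id x (m : jet_at E x) : pairing m (id_gauge x) = jet_proj m.
Proof. by []. Qed.

Lemma jet_projD x (m m' : jet_at E x) :
  jet_proj (m + m') = jet_proj m + jet_proj m'.
Proof. exact: (pairingD (id_gauge x)). Qed.

Lemma jet_projZ x c (m : jet_at E x) : jet_proj (c *: m) = c *: jet_proj m.
Proof. exact: (pairingZ (id_gauge x)). Qed.

Lemma jet_proj_comb x (a b c : jet_at E x) :
  jet_proj (a + (-1) *: b + c) = jet_proj a - jet_proj b + jet_proj c.
Proof. by rewrite jet_projD jet_projD jet_projZ scaleN1r. Qed.

(** The operator is a local flat connection: it differentiates the components in a frame along [w].
    Two bump functions globalize it: [c] turns the components into global functions, and [b]
    restricts [w] to the region where the frame is valid and [c] is 1. *)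
Lemma gauge_of_vfield (w : sec (TM M)) x0 :
  exists G : sec (gauge_bundle E), \forall y \near x0, has_symbol (G y) (w y).
Proof.
have [i ix] := triv_cover E x0; have [e eE] := local_frame ix.
have [c [c1 cU]] := bump_exists (near_triv_dom ix).
have cs k u : smooth_fun (fun y => c y * triv i y (u y) 0 k).
  by apply: (bump_smooth cU) => y iy; exact: sec_smooth_at.
pose C k u := MkCinf (cs k u).
have [b [b1 bU]] := bump_exists (filterI (nbhs_interior eE) (nbhs_interior c1)).
have [bw bwE] : exists bw : sec (TM M), forall y, bw y = b y *: w y.
  by exists (fmul b w).
pose G y u := \sum_k bw y (C k u) *: e k y : E y.
have CZ k f u : C k (fmul f u) = Cinf_mul f (C k u).
  by apply: Cinf_eq => y /=; rewrite linearZ mxE mulrCA.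
have Gsym y f u : G y (fmul f u) = f y *: G y u + bw y f *: u y.
  rewrite /G scaler_sumr; have [[ey cy]|b0] := bU y; last first.
    rewrite bwE (nbhs_singleton b0) !scale0r addr0.
    by rewrite !big1// => k _; rewrite scale0r ?scaler0.
  have [iy eky] := nbhs_singleton ey; have c1y := nbhs_singleton cy.
  rewrite [u y in RHS](triv_expand _ iy) scaler_sumr -big_split /=.
  apply: eq_bigr => k _; rewrite CZ tangentM scalerDl scalerA.
  congr (_ + _); rewrite scalerA mulrC eky /=; congr ((_ * _) *: _).
  by rewrite /= c1y mul1r.
have Glin y a u u' : G y (a *: u + u') = a *: G y u + G y u'.
  rewrite /G scaler_sumr -big_split /=; apply: eq_bigr => k _.
  rewrite scalerA -scalerDl; congr (_ *: _).
  by apply: tangent_lin => z; rewrite /= linearD linearZ !mxE mulrDr mulrCA.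
have GP y : is_gauge (G y).
  by apply/asboolP; split; [exact: Glin|exists (bw y); exact: Gsym].
have Gs : gauge_smooth (fun y => GaugeAt (GP y)).
  split=> [u|]; last by exists (bw); exact: Gsym.
  have -> : (fun x => GaugeAt (GP x) u) =
      (\sum_k fmul (vderiv (bw) (C k u)) (e k) : sec E).
    by apply: functional_extensionality_dep => y; rewrite sec_sumE.
  exact: secP.
exists (Sec (Gs : smooth_sec (b := gauge_bundle E) _)).
apply: filterS b1 => y b1y f u /=; rewrite Gsym bwE b1y scale1r.
by [].
Unshelve. all: by end_near. Qed.

Lemma gauge_with_symbol x (t : tangent x) : exists d : gauge_at E x, has_symbol d t.
Proof.
have [w wx] := vfield_through t; have [G /nbhs_singleton Gx] := gauge_of_vfield w x.
by exists (G x); rewrite -wx.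
Qed.

(* The first jet of [u] at [x] consists of [u x], detected by the identity, and of the first
   derivatives of [u], detected by operators whose symbols are coordinate derivatives. *)
Lemma pairing_nondeg x (m : jet_at E x) :
  (forall d : sec (gauge_bundle E), pairing m (d x) = 0) -> m = 0.
Proof.
rewrite -[m]jet_repr; move: (repr m) => {m} u H.
rewrite -(_ : jet x 0 = 0); last by apply: (addrI (jet x 0)); rewrite -jetD !addr0.
apply/jet_eq; rewrite subr0; apply/asboolP => i j ix jx k.
have ux : u x = 0 by have := H id_gauge; rewrite pairing_jet.
split=> [|w]; first by rewrite /coef chartK// ux linear0 mxE.
have [W Ww] := coord_vfield w jx; have [G /nbhs_singleton Gx] := gauge_of_vfield W x.
have [e eE] := local_frame ix; have [c cE] := local_coef u ix.
have := H G; rewrite pairing_jet (gauge_expand eE cE Gx).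
move=> /(congr1 (fun v => triv i x v 0 k)).
rewrite linear0 linear_sum summxE mxE (bigD1 k)//= big1 => [|l lk].
  rewrite addr0 linearD !linearZ /= !mxE ux linear0 mxE mul0r add0r.
  rewrite (nbhs_singleton eE).2 trivVK// mxE !eqxx mulr1.
  rewrite (nbhs_singleton Ww) => <-; apply: near_eq_derive.
  by apply: filterS (near_chartV jx cE) => z /(_ k).
rewrite linearD !linearZ /= !mxE ux linear0 mxE mul0r add0r.
by rewrite (nbhs_singleton eE).2 trivVK// mxE eqxx eq_sym (negPf lk) mulr0.
Qed.

Lemma pairing_smooth (m : sec (JE E)) (d : sec (gauge_bundle E)) :
  vb_smooth (fun x => pairing (m x) (d x)).
Proof.
apply/vb_smoothP => x; have [l ml] := (secP m : jet_smooth _) x.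
pose s : sec E := \sum_(p <- l) fmul p.1 (gauge_act d p.2).
suff sE : \forall y \near x, s y = pairing (m y) (d y).
  exact: vb_smooth_at_eq sE (@sec_smooth_at s x).
near=> y; apply/esym.
rewrite (_ : m y = \sum_(p <- l) p.1 y *: jet y p.2); last by near: y.
rewrite pairing_sum sec_sumE; apply: eq_bigr => p _.
by rewrite pairingZ pairing_jet.
Unshelve. all: by end_near. Qed.

Lemma pairing_secE (m : sec (JE E)) (d : sec (gauge_bundle E)) x :
  pairing_sec m d x = pairing (m x) (d x).
Proof. by rewrite /pairing_sec (mksecE (V := E))//; exact: pairing_smooth. Qed.

(** A frame section is nonzero at [x], and the Leibniz rule on its multiples reads the symbol off.
    In rank 0 every tangent vector would be a symbol. *)
Lemma symbol_unique x (d : gauge_at E x) v w : (0 < r)%N ->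
  has_symbol d v -> has_symbol d w -> v = w.
Proof.
move=> r0 dv dw; have [i ix] := triv_cover E x.
have [e /nbhs_singleton[_ eE]] := local_frame ix.
apply: tangent_eq => f; have := dv f (e (Ordinal r0)); rewrite dw => /addrI /eqP.
rewrite -subr_eq0 -scalerBl scaler_eq0 subr_eq0 => /orP[/eqP//|].
rewrite eE => /eqP/(congr1 (triv i x)); rewrite trivVK// linear0.
move=> /matrixP/(_ 0 (Ordinal r0)); rewrite !mxE !eqxx => /eqP.
by rewrite oner_eq0.
Qed.

Lemma anchorE x (d : gauge_at E x) v : (0 < r)%N -> has_symbol d v -> anchor d = v.
Proof.
move=> r0 dv; apply: (symbol_unique r0 _ dv).
by rewrite /anchor; case: xgetP => [w _//|/(_ v)].
Qed.

End VectorBundleTheory.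

(** * The Lie derivative and the falling operator *)

Section LieDerivative.
Context {R : realType} {n : nat} {M : manifold R n} {r : nat}
  (E : vector_bundle M r).
Implicit Types (x : M) (m : sec (JE E)) (d : sec (gauge_bundle E)).

Definition jet_leibniz d (l : seq (Cinf M * sec E)) x : jet_at E x :=
  \sum_(p <- l) (p.1 x *: jet x (gauge_act d p.2) + symb d x p.1 *: jet x p.2).

Lemma jet_leibnizP d m (l : seq (Cinf M * sec E)) x :
  (\forall y \near x, m y = \sum_(p <- l) p.1 y *: jet y p.2) ->
  forall d', pairing (jet_leibniz d l x) (d' x) =
    d x (pairing_sec m d') - pairing (m x) (gauge_comm d d' x).
Proof.
move=> ml d'.
have -> : d x (pairing_sec m d') = d x (\sum_(p <- l) fmul p.1 (gauge_act d' p.2)).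
  apply: gauge_near; near=> y; rewrite pairing_secE sec_sumE.
  rewrite (_ : m y = \sum_(p <- l) p.1 y *: jet y p.2); last by near: y.
  by rewrite pairing_sum; apply: eq_bigr => p _; rewrite pairingZ pairing_jet.
rewrite (nbhs_singleton ml) !pairing_sum gauge_sum -sumrB.
apply: eq_bigr => p _; rewrite pairingD !pairingZ !pairing_jet symbP gauge_commE /=.
by rewrite scalerBr addrAC opprB addrCA subrr addr0.
Unshelve. all: by end_near. Qed.

(** A presentation [l x] of [m] is chosen at each [x]. At [y] near [x] the expressions from [l x]
    and [l y] have the same pairing with every operator, so nondegeneracy identifies them; hence the
    resulting family is smooth. *)
Lemma lie_deriv_exists d m : exists m' : sec (JE E), forall d',
  pairing_sec m' d' = gauge_act d (pairing_sec m d') - pairing_sec m (gauge_comm d d').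
Proof.
have [l lE] := choice (secP m : jet_smooth _).
have ls : jet_smooth (fun x => jet_leibniz d (l x) x).
  move=> x; exists ([seq (p.1, gauge_act d p.2) | p <- l x] ++
                    [seq (vderiv (symb d) p.1, p.2) | p <- l x]).
  near=> y; rewrite big_cat !big_map /= -big_split /=.
  have ly : \forall z \near y, m z = \sum_(p <- l x) p.1 z *: jet z p.2.
    by near: y; exact: nbhs_interior (lE x).
  apply/eqP; rewrite -subr_eq0; apply/eqP; apply: pairing_nondeg => d'.
  by rewrite pairingB (jet_leibnizP d (lE y)) (jet_leibnizP d ly) subrr.
exists (Sec (ls : smooth_sec (b := JE E) _)) => d'; apply: sec_eq => x.
by rewrite pairing_secE /= (jet_leibnizP d (lE x)) scaleN1r pairing_secE.
Unshelve. all: by end_near. Qed.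

Lemma lie_derivP d m d' :
  pairing_sec (lie_deriv d m) d' =
  gauge_act d (pairing_sec m d') - pairing_sec m (gauge_comm d d').
Proof.
have [m' m'P] := lie_deriv_exists d m.
by rewrite /lie_deriv; case: xgetP => [m'' _ //|/(_ m')[]].
Qed.

Definition jet_proj_sec m : sec E := pairing_sec m id_gauge.

Lemma jet_proj_secE m x : jet_proj_sec m x = jet_proj (m x).
Proof. by rewrite pairing_secE. Qed.

Lemma jet_proj_sec_sub m (u : sec E) :
  jet_proj_sec (m - jet_sec u) = jet_proj_sec m - u.
Proof.
apply: sec_eq => x; rewrite jet_proj_secE.
rewrite -[RHS]/(jet_proj_sec m x + (-1) *: u x) jet_proj_secE -(jet_proj_jet x u).
by rewrite -jet_projZ; exact: jet_projD.
Qed.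

Lemma jet_proj_lie_deriv d m x : jet_proj (lie_deriv d m x) = d x (jet_proj_sec m).
Proof.
rewrite -jet_proj_secE /jet_proj_sec lie_derivP /= pairing_secE.
have -> : gauge_comm d id_gauge x = 0.
  apply: gauge_eq => u; rewrite gauge_commE.
  by rewrite (_ : gauge_act id_gauge u = u) ?subrr//; exact: sec_eq.
by rewrite /pairing /= scaler0 addr0.
Qed.

(** The difference of [m] and the jet of its projection is represented at [x] by a section vanishing
    there, on which [g - g'], having zero symbol, gives 0. *)
Lemma pairing_symbol x (m : sec (JE E)) (g g' : gauge_at E x) v :
  has_symbol g v -> has_symbol g' v ->
  pairing (m x) g - g (jet_proj_sec m) = pairing (m x) g' - g' (jet_proj_sec m).
Proof.
move=> gv gv'; rewrite /pairing -!gaugeB; set u := _ - _.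
have ux : u x = 0 by rewrite /u /= jet_proj_secE scaleN1r subrr.
have s0 : has_symbol (g - g') 0.
  move=> f w; rewrite -[(g - g') _]/(g (fmul f w) - g' (fmul f w)) gv gv'.
  rewrite -[(g - g') _]/(g w - g' w) -[(0 : tangent x) f]/(0 : R).
  by rewrite scale0r addr0 scalerBr opprD addrACA subrr addr0.
apply/eqP; rewrite -subr_eq0 -[X in X == _]/((g - g') u); apply/eqP.
exact: gauge_symbol0.
Qed.

End LieDerivative.

(** * The formula for b{X,Y} and an explicit falling operator *)

Section Falling.
Context {R : realType} {n : nat} {M : manifold R n} {r : nat}
  (E : vector_bundle M r) (r_gt0 : (0 < r)%N).
Implicit Types (x : M) (X Y : sec (omni E)).

Lemma anchor_linear x (c : R) (d d' : gauge_at E x) :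
  anchor (c *: d + d') = c *: anchor d + anchor d'.
Proof.
have [v dv] := gauge_symbol d; have [v' dv'] := gauge_symbol d'.
rewrite (anchorE r_gt0 dv) (anchorE r_gt0 dv'); apply: (anchorE r_gt0) => f u.
rewrite -[(c *: d + d') _]/(c *: d (fmul f u) + d' (fmul f u)) dv dv'.
rewrite -[(c *: d + d') _]/(c *: d u + d' u).
rewrite -[(c *: v + v') f]/(c * v f + v' f).
rewrite !scalerDr scalerDl addrACA; congr (_ + _ + (_ + _)).
  by rewrite !scalerA mulrC.
by rewrite scalerA.
Qed.

Lemma bmap_linear x (c : R) (v w : omni E x) :
  bmap (c *: v + w) = c *: bmap v + bmap w :> Tau E x.
Proof.
rewrite /bmap anchor_linear -pairing_id pairing_linear.
by [].
Qed.

Lemma bmap0 x : bmap 0 = 0 :> Tau E x.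
Proof.
by have := bmap_linear (-1) (0 : omni E x) 0; rewrite scaler0 addr0 scaleN1r addNr.
Qed.

Lemma bmapZ x (c : R) (v : omni E x) : bmap (c *: v) = c *: bmap v :> Tau E x.
Proof. by have := bmap_linear c v 0; rewrite bmap0 !addr0. Qed.

Lemma bmap_sum x (I : Type) (s : seq I) (F : I -> omni E x) :
  bmap (\sum_(i <- s) F i) = \sum_(i <- s) bmap (F i) :> Tau E x.
Proof.
elim: s => [|i s IH]; first by rewrite !big_nil bmap0.
by rewrite !big_cons -IH -[F i]scale1r bmap_linear !scale1r.
Qed.

(** The smooth representatives on the right show that the pointwise [bmap (X x)] form a smooth
    family, so the default value in [mksec] does not occur. *)
Lemma bsec_pair X :
  bsec X = sec_pair (symb (sec_fst X)) (jet_proj_sec (sec_snd X)).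
Proof.
have E1 x : bmap (X x) = (symb (sec_fst X) x, jet_proj_sec (sec_snd X) x) :> Tau E x.
  by rewrite /bmap (anchorE r_gt0 (symbP (sec_fst X) x)) jet_proj_secE.
apply: sec_eq => x; rewrite /bsec mksecE ?E1//.
rewrite (_ : (fun x => bmap (X x)) =
  (fun x => (symb (sec_fst X) x, jet_proj_sec (sec_snd X) x))).
  exact: sec_pair_smooth.
by apply: functional_extensionality_dep.
Qed.

Lemma bsecE X x : bsec X x = bmap (X x).
Proof.
rewrite bsec_pair /bmap (anchorE r_gt0 (symbP (sec_fst X) x)).
by rewrite -[jet_proj _]/(jet_proj (sec_snd X x)) -jet_proj_secE.
Qed.

Lemma bsecZ (f : Cinf M) X : bsec (fmul f X) = fmul f (bsec X).
Proof. by apply: sec_eq => x; rewrite bsecE /= bsecE bmapZ. Qed.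

Lemma bsec_courant X Y x : bsec (courant X Y) x =
  (vbracket (symb (sec_fst X)) (symb (sec_fst Y)) x,
   sec_fst X x (jet_proj_sec (sec_snd Y)) - sec_fst Y x (jet_proj_sec (sec_snd X)) +
   pairing (sec_snd X x) (sec_fst Y x)) :> Tau E x.
Proof.
rewrite bsecE /bmap /courant /=; congr (_, _).
  by apply: (anchorE r_gt0); exact: gauge_comm_symbol.
transitivity (jet_proj (lie_deriv (sec_fst X) (sec_snd Y) x) -
  jet_proj (lie_deriv (sec_fst Y) (sec_snd X) x) +
  jet_proj (jet x (pairing_sec (sec_snd X) (sec_fst Y)))).
  exact: jet_proj_comb.
congr (_ - _ + _); [exact: jet_proj_lie_deriv|exact: jet_proj_lie_deriv|].
by rewrite jet_proj_jet pairing_secE.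
Qed.

(* For [w] in the tangent space at [x], the term [<m, g> - g (p m)] is the same for all [g] with
   symbol [w]. *)
Definition jet_defect (m : sec (JE E)) x (w : tangent x) : E x :=
  let g := xget (0 : gauge_at E x) [set g | has_symbol g w] in
  pairing (m x) g - g (jet_proj_sec m).

Lemma jet_defectE (m : sec (JE E)) x (g : gauge_at E x) w : has_symbol g w ->
  jet_defect m w = pairing (m x) g - g (jet_proj_sec m).
Proof.
move=> gw; rewrite /jet_defect; apply: (pairing_symbol m _ gw).
by case: xgetP => [g' _//|/(_ g)].
Qed.

Lemma jet_defect_linear (m : sec (JE E)) x c (v w : tangent x) :
  jet_defect m (c *: v + w) = c *: jet_defect m v + jet_defect m w.
Proof.
have [g gv] := gauge_with_symbol E v; have [g' gw] := gauge_with_symbol E w.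
have gs : has_symbol (c *: g + g') (c *: v + w).
  have [u gu] := gauge_symbol (c *: g + g').
  have := anchor_linear c g g'.
  by rewrite (anchorE r_gt0 gv) (anchorE r_gt0 gw) (anchorE r_gt0 gu) => <-.
rewrite (jet_defectE m gv) (jet_defectE m gw) (jet_defectE m gs).
rewrite /pairing -!gaugeB.
by [].
Qed.

Lemma jet_defect_smooth (m : sec (JE E)) (w : sec (TM M)) :
  vb_smooth (fun x => jet_defect m (w x)).
Proof.
apply/vb_smoothP => x; have [G Gw] := gauge_of_vfield E w x.
have sE : \forall y \near x,
    (pairing_sec m G - gauge_act G (jet_proj_sec m) : sec E) y = jet_defect m (w y).
  apply: filterS Gw => y Gy; rewrite (jet_defectE m Gy) /= pairing_secE.
  by rewrite scaleN1r.
exact: vb_smooth_at_eq sE (@sec_smooth_at _ _ _ _ _ _ x).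
Qed.

Lemma vbracketZ (v w : sec (TM M)) (f : Cinf M) x :
  vbracket v (fmul f w) x = f x *: vbracket v w x + v x f *: w x.
Proof.
apply: tangent_eq => g; rewrite vbracketE.
rewrite (_ : vderiv (fmul f w) g = Cinf_mul f (vderiv w g)); last exact: Cinf_eq.
rewrite tangentM -[RHS]/(f x * vbracket v w x g + v x f * w x g) vbracketE.
rewrite -[LHS]/(f x * v x (vderiv w g) + w x g * v x f - f x * w x (vderiv v g)).
by rewrite mulrBr addrAC [w x g * _]mulrC.
Qed.

Lemma vbracket_linear (v : sec (TM M)) (c : R) (w w' : sec (TM M)) x :
  vbracket v (c *: w + w') x = c *: vbracket v w x + vbracket v w' x.
Proof.
apply: tangent_eq => g.
rewrite -[RHS]/(c * vbracket v w x g + vbracket v w' x g) !vbracketE.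
rewrite (@tangent_lin _ _ _ _ (v x) c (vderiv w g) (vderiv w' g))//.
rewrite -[(c *: w + w') x _]/(c * w x (vderiv v g) + w' x (vderiv v g)).
by rewrite opprD addrACA mulrBr.
Qed.

Lemma jet_defectZ (m : sec (JE E)) x c (v : tangent x) :
  jet_defect m (c *: v) = c *: jet_defect m v.
Proof.
have d0 : jet_defect m (0 : tangent x) = 0.
  have := jet_defect_linear m (-1) (0 : tangent x) 0.
  by rewrite scaler0 addr0 scaleN1r addNr.
by have := jet_defect_linear m c v 0; rewrite d0 !addr0.
Qed.

(** This is b{X,Y} at [x] with the symbol of Y's operator and the projection of Y's jet replaced by
    the two components of [t]. The term [jet_defect] collects what depends on that operator only
    through its symbol. *)
Definition falling_at X x (t : sec (Tau E)) : Tau E x :=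
  (vbracket (symb (sec_fst X)) (sec_fst t) x,
   sec_fst X x (sec_snd t) + jet_defect (sec_snd X) (sec_fst t x)).

Lemma falling_at_linear X x c t t' :
  falling_at X x (c *: t + t') = c *: falling_at X x t + falling_at X x t'.
Proof.
rewrite /falling_at.
rewrite (_ : sec_fst (c *: t + t') = c *: sec_fst t + sec_fst t'); last exact: sec_eq.
rewrite (_ : sec_snd (c *: t + t') = c *: sec_snd t + sec_snd t'); last exact: sec_eq.
rewrite vbracket_linear gauge_linear.
rewrite -[(c *: sec_fst t + sec_fst t') x]/(c *: sec_fst t x + sec_fst t' x).
rewrite jet_defect_linear addrACA -scalerDr.
by [].
Qed.

Lemma falling_at_symbol X x : has_symbol (falling_at X x) (symb (sec_fst X) x).
Proof.
move=> f t; rewrite /falling_at.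
rewrite (_ : sec_fst (fmul f t) = fmul f (sec_fst t)); last exact: sec_eq.
rewrite (_ : sec_snd (fmul f t) = fmul f (sec_snd t)); last exact: sec_eq.
rewrite vbracketZ symbP -[fmul f (sec_fst t) x]/(f x *: sec_fst t x) jet_defectZ.
rewrite addrAC -scalerDr.
by [].
Qed.

Lemma falling_at_is_gauge X x : is_gauge (falling_at X x).
Proof.
apply/asboolP; split; first exact: falling_at_linear.
by exists (symb (sec_fst X) x); exact: falling_at_symbol.
Qed.

Lemma falling_op_smooth X :
  gauge_smooth (fun x => GaugeAt (falling_at_is_gauge X x)).
Proof.
split=> [t|]; last by exists (symb (sec_fst X)) => x; exact: falling_at_symbol.
split; first exact: (secP (vbracket (symb (sec_fst X)) (sec_fst t))).
exact: (vb_smoothD (secP (gauge_act (sec_fst X) (sec_snd t)) : vb_smooth _)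
  (jet_defect_smooth (sec_snd X) (sec_fst t))).
Qed.

Definition falling_op X : sec (gauge_bundle (Tau E)) :=
  Sec (falling_op_smooth X : smooth_sec (b := gauge_bundle (Tau E)) _).

Lemma falling_opE X Y : gauge_act (falling_op X) (bsec Y) = bsec (courant X Y).
Proof.
apply: sec_eq => x; rewrite bsec_courant bsec_pair -[LHS]/(falling_at _ _ _) /falling_at.
rewrite (_ : sec_fst (sec_pair _ _) = symb (sec_fst Y)); last exact: sec_eq.
rewrite (_ : sec_snd (sec_pair _ _) = jet_proj_sec (sec_snd Y)); last exact: sec_eq.
by rewrite (jet_defectE _ (symbP (sec_fst Y) x)) addrA addrAC.
Qed.

Lemma fallingP X Y : gauge_act (falling X) (bsec Y) = bsec (courant X Y).
Proof.
rewrite /falling; case: xgetP => [D _ //|/(_ (falling_op X))[]].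
exact: falling_opE.
Qed.

End Falling.

(** * Frames of subbundles *)

Section SmoothMatrices.
Context {R : realType} {n : nat} {M : manifold R n}.
Implicit Types x : M.

Definition smooth_mx_at p q (A : M -> 'M[R]_(p, q)) x :=
  forall i j, smooth_fun_at (fun y => A y i j) x.

Lemma smooth_mulmx p q s (A : M -> 'M[R]_(p, q)) (B : M -> 'M[R]_(q, s)) x :
  smooth_mx_at A x -> smooth_mx_at B x -> smooth_mx_at (fun y => A y *m B y) x.
Proof.
move=> sA sB i j; apply: (@smooth_fun_at_eq _ _ _ (fun y => \sum_k A y i k * B y k j)).
  by near=> y; rewrite mxE.
by apply: smooth_fun_at_sum => k; apply: smooth_fun_atM; [exact: sA|exact: sB].
Unshelve. all: by end_near. Qed.

Lemma smooth_trmx p q (A : M -> 'M[R]_(p, q)) x :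
  smooth_mx_at A x -> smooth_mx_at (fun y => (A y)^T) x.
Proof.
move=> sA i j; apply: smooth_fun_at_eq (sA j i).
by near=> y; rewrite mxE.
Unshelve. all: by end_near. Qed.

Lemma smooth_det p (A : M -> 'M[R]_p) x :
  smooth_mx_at A x -> smooth_fun_at (fun y => \det (A y)) x.
Proof.
move=> sA; apply: smooth_fun_at_sum => s; apply: smooth_fun_atM.
  exact: smooth_fun_at_cst.
by apply: smooth_fun_at_prod => i; exact: sA.
Qed.

Lemma near_unitmx p (A : M -> 'M[R]_p) x : A x \in unitmx ->
  smooth_mx_at A x -> \forall y \near x, A y \in unitmx.
Proof.
rewrite unitmxE unitfE => dA sA.
have near_det : \forall y \near x, \det (A y) != 0.
  have : nbhs (\det (A x)) [set c | c != 0].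
    by apply: open_nbhs_nbhs; split => //; exact: open_neq.
  by move/(smooth_fun_cvg (smooth_det sA)).
by apply: filterS near_det => y; rewrite unitmxE unitfE.
Qed.

Lemma smooth_invmx p (A : M -> 'M[R]_p) x : A x \in unitmx ->
  smooth_mx_at A x -> smooth_mx_at (fun y => invmx (A y)) x.
Proof.
rewrite unitmxE unitfE => dA sA i j; have sd := smooth_det sA.
apply: (@smooth_fun_at_eq _ _ _ (fun y => (\det (A y))^-1 * (\adj (A y)) i j)).
  have uA : A x \in unitmx by rewrite unitmxE unitfE.
  apply: filterS (near_unitmx uA sA) => y uy.
  by rewrite /invmx uy !mxE.
apply: smooth_fun_atM; first exact: smooth_fun_atV.
apply: (@smooth_fun_at_eq _ _ _ (fun y => cofactor (A y) j i)).
  by near=> y; rewrite mxE.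
apply: smooth_fun_atM; first exact: smooth_fun_at_cst.
by apply: smooth_det => k l; apply: smooth_fun_at_eq (sA (lift j k) (lift i l));
  near=> y; rewrite !mxE.
Unshelve. all: by end_near. Qed.

End SmoothMatrices.

(** A row [v] in the kernel of the Gram matrix makes the sum of squares of the entries of [v *m B]
    vanish, which over the reals gives [v *m B = 0]. *)
Lemma gram_unitmx (R : realType) p q (B : 'M[R]_(p, q)) :
  (forall v : 'rV_p, v *m B = 0 -> v = 0) -> B *m B^T \in unitmx.
Proof.
move=> Binj; rewrite -row_free_unit; apply: inj_row_free => v vG; apply: Binj.
have : (v *m B) *m (v *m B)^T = 0 by rewrite trmx_mul mulmxA -(mulmxA v) vG mul0mx.
move=> /matrixP/(_ 0 0); rewrite !mxE => /eqP.
rewrite psumr_eq0 => [/allP H|i _]; last by rewrite [(_^T) _ _]mxE -expr2 sqr_ge0.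
apply/rowP => j; have := H j; rewrite mem_index_enum => /(_ isT) /=.
by rewrite [(_^T) _ _]mxE mulf_eq0 orbb => /eqP ->; rewrite mxE.
Qed.

(** * Smooth coefficients with respect to frames in the sum of TM and E *)

Section Frames.
Context {R : realType} {n : nat} {M : manifold R n} {r : nat}
  (E : vector_bundle M r).
Implicit Types x : M.

(** A local trivialization: derivatives of coordinate functions on the tangent part, components in a
    trivialization on [E]. It turns questions about frames into matrix computations. *)
Lemma Tau_coords x0 : exists xi : forall y : M, Tau E y -> 'rV[R]_(n + r),
  [/\ forall y c (t t' : Tau E y), xi y (c *: t + t') = c *: xi y t + xi y t',
    \forall y \near x0, forall t, xi y t = 0 -> t = 0 &
    \forall y \near x0, forall s : sec (Tau E),
      smooth_mx_at (fun z => xi z (s z)) y].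
Proof.
have [j jx] := dom_cover x0; have [i ix] := triv_cover E x0.
have [X XE] := chart_coords jx.
exists (fun y (t : Tau E y) => row_mx (\row_k (t.1 (X k) : R)) (triv i y t.2)); split.
- move=> y c t t'; rewrite scale_row_mx add_row_mx; congr row_mx; last exact: linearP.
  by apply/rowP => k; rewrite [LHS]mxE [RHS]mxE !mxE; exact: tangent_combE.
- near=> y => -[v e] /= H; have iy : triv_dom i y by near: y; exact: near_triv_dom.
  have jy : chart_dom j y by near: y; exact: near_dom.
  have [v0 e0] : \row_k (v (X k) : R) = 0 /\ triv i y e = 0.
    by apply/eq_row_mx; rewrite H row_mx0.
  have [w vw] := tangent_chart v jy; congr (_, _).
    apply: tangent_eq => f; rewrite vw (_ : w = 0).
      by rewrite derive0.
    apply/rowP => k; have := congr1 (fun m : 'rV_n => m 0 k) v0.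
    rewrite !mxE vw => <-.
    have Xy : forall k (a : 'rV[R]_n),
      'D_a (X k \o chartV j) (chart j y) = a 0 k by near: y.
    by rewrite Xy.
  by apply: (triv_inj iy); rewrite e0 linear0.
- near=> y => s a b; rewrite ord1 {a}.
  have iy : triv_dom i y by near: y; exact: near_triv_dom.
  case: (split_ordP b) => k ->.
    apply: (@smooth_fun_at_eq _ _ _ (vderiv (sec_fst s) (X k))); last exact: Cinf_at.
    by near=> z; rewrite row_mxEl mxE.
  apply: smooth_fun_at_eq (@sec_smooth_at _ _ _ _ E (sec_snd s) y i iy k).
  by near=> z; rewrite row_mxEr.
Unshelve. all: by end_near. Qed.

(* The coefficients are obtained from the inverse Gram matrix of the frame. *)
Lemma frame_coefs k (e : 'I_k -> sec (Tau E)) (s : sec (Tau E)) x0 :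
  (\forall y \near x0,
    (forall c : 'I_k -> R, \sum_i c i *: e i y = 0 -> forall i, c i = 0) /\
    exists c : 'I_k -> R, s y = \sum_i c i *: e i y) ->
  exists c : 'I_k -> Cinf M, \forall y \near x0, s y = \sum_i c i y *: e i y.
Proof.
move=> es; have [xi [xi_lin xi_inj xi_smooth]] := Tau_coords x0.
have xi0 y : xi y 0 = 0.
  by have := xi_lin y (-1) 0 0; rewrite scaler0 addr0 scaleN1r addNr.
have xi_sum y (c : 'I_k -> R) : xi y (\sum_i c i *: e i y) = \sum_i c i *: xi y (e i y).
  elim: (index_enum _) => [|i l IH]; first by rewrite !big_nil xi0.
  by rewrite !big_cons xi_lin IH.
pose B y : 'M[R]_(k, n + r) := \matrix_(i, l) xi y (e i y) 0 l.
have BE y (c : 'I_k -> R) : xi y (\sum_i c i *: e i y) = (\row_i c i) *m B y.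
  rewrite xi_sum; apply/rowP => l; rewrite !mxE summxE.
  by apply: eq_bigr => i _; rewrite !mxE.
pose C y := xi y (s y) *m (B y)^T *m invmx (B y *m (B y)^T).
have unitG : \forall y \near x0, B y *m (B y)^T \in unitmx.
  near=> y; apply: gram_unitmx => v vB.
  have [ey _] : (forall c : 'I_k -> R, \sum_i c i *: e i y = 0 -> forall i, c i = 0) /\
      exists c : 'I_k -> R, s y = \sum_i c i *: e i y by near: y.
  have vE : v = \row_i v 0 i by apply/rowP => i; rewrite mxE.
  apply/rowP => i; rewrite mxE; apply: (ey (fun i => v 0 i)).
  have : xi y (\sum_i v 0 i *: e i y) = 0 by rewrite BE -vE.
  suff : forall t, xi y t = 0 -> t = 0 by apply.
  by near: y.
have sB : \forall y \near x0, smooth_mx_at B y.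
  near=> y => i l; apply: (@smooth_fun_at_eq _ _ _ (fun z => xi z (e i z) 0 l)).
    by near=> z; rewrite mxE.
  have : forall s : sec (Tau E), smooth_mx_at (fun z => xi z (s z)) y by near: y.
  by apply.
have sC i : \forall y \near x0, smooth_fun_at (fun z => C z 0 i) y.
  near=> y; have sBy : smooth_mx_at B y by near: y.
  have sxi : forall s : sec (Tau E), smooth_mx_at (fun z => xi z (s z)) y by near: y.
  have : smooth_mx_at C y; last by exact.
  apply: smooth_mulmx; first by apply: smooth_mulmx => //; exact: smooth_trmx.
  apply: smooth_invmx; first by near: y.
  by apply: smooth_mulmx => //; exact: smooth_trmx.
have [c cE] := choice (fun i => extend_smooth (sC i)).
exists c; near=> y.
have [_ [a aE]] : (forall c : 'I_k -> R, \sum_i c i *: e i y = 0 -> forall i, c i = 0) /\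
    exists c : 'I_k -> R, s y = \sum_i c i *: e i y by near: y.
have Gy : B y *m (B y)^T \in unitmx by near: y.
rewrite [LHS]aE; apply: eq_bigr => i _; congr (_ *: _).
rewrite (_ : c i y = C y 0 i); last by move: i; near: y; exact: (filter_forall _ cE).
by rewrite /C aE BE -(mulmxA _ (B y)) mulmxK// mxE.
Unshelve. all: by end_near. Qed.

(* The transition matrix from [a] to [t] is the identity at [x0], hence
   invertible near [x0]. *)
Lemma perturbed_frame (S : forall x, set (Tau E x)) k (a t : 'I_k -> sec (Tau E))
    (s : sec (Tau E)) x0 :
  (\forall y \near x0, is_basis (S y) (fun i => a i y)) ->
  (\forall y \near x0, forall j, S y (t j y)) -> (forall j, t j x0 = a j x0) ->
  (\forall y \near x0, S y (s y)) ->
  exists c : 'I_k -> Cinf M, \forall y \near x0, s y = \sum_i c i y *: t i y.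
Proof.
move=> aB tS ta sS.
have coefs (u : sec (Tau E)) : (\forall y \near x0, S y (u y)) ->
    exists c : 'I_k -> Cinf M, \forall y \near x0, u y = \sum_i c i y *: a i y.
  move=> uS; apply: frame_coefs; near=> y.
  have [Sy ind] : is_basis (S y) (fun i => a i y) by near: y.
  split=> //; have : S y (u y) by near: y.
  by rewrite Sy.
have tS' j : \forall y \near x0, S y (t j y) by apply: filterS tS => y; exact.
have [Q QE] := choice (fun j => coefs (t j) (tS' j)).
have {}QE : \forall y \near x0, forall j, t j y = \sum_i Q j i y *: a i y.
  exact: (filter_forall _ QE).
have [b bE] := coefs s sS.
pose T y : 'M[R]_k := \matrix_(j, i) Q j i y.
have sT y : smooth_mx_at T y.
  move=> j i; apply: (@smooth_fun_at_eq _ _ _ (fun z => Q j i z));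
    last exact: Cinf_at.
  by near=> z; rewrite mxE.
have T1 : T x0 = 1%:M.
  apply/matrixP => j i; rewrite !mxE.
  have [_ ind] := nbhs_singleton aB; have := nbhs_singleton QE j; rewrite ta => aQ.
  have : Q j i x0 - (j == i)%:R = 0.
    apply: (ind (fun i => Q j i x0 - (j == i)%:R)).
    under eq_bigr do rewrite scalerBl.
    rewrite sumrB -aQ (bigD1 j)//= eqxx scale1r big1 ?addr0 ?subrr// => l lj.
    by rewrite eq_sym (negPf lj) scale0r.
  by move/eqP; rewrite subr_eq0 => /eqP.
have unitT : \forall y \near x0, T y \in unitmx.
  by apply: near_unitmx => //; rewrite T1 unitmx1.
pose C y := (\row_i (b i y : R)) *m invmx (T y).
have sC i : \forall y \near x0, smooth_fun_at (fun z => C z 0 i) y.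
  near=> y; have : smooth_mx_at C y; last by exact.
  apply: smooth_mulmx.
    move=> p q; apply: (@smooth_fun_at_eq _ _ _ (fun z => b q z));
      last exact: Cinf_at.
    by near=> z; rewrite mxE.
  by apply: smooth_invmx => //; near: y.
have [c cE] := choice (fun i => extend_smooth (sC i)).
exists c; near=> y.
have cy i : c i y = C y 0 i by move: i; near: y; exact: (filter_forall _ cE).
have ty j : t j y = \sum_i Q j i y *: a i y by move: j; near: y.
rewrite (_ : s y = \sum_i b i y *: a i y); last by near: y.
under [RHS]eq_bigr do rewrite ty cy scaler_sumr.
rewrite exchange_big /=; apply: eq_bigr => i _.
under eq_bigr do rewrite scalerA.
rewrite -scaler_suml; congr (_ *: _).
have : C y *m T y = \row_i (b i y : R) by rewrite /C mulmxKV//; near: y.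
move=> /matrixP/(_ 0 i); rewrite !mxE => <-.
by apply: eq_bigr => j _; rewrite [T y j i]mxE.
Unshelve. all: by end_near. Qed.

End Frames.

(** * Global sections of a subbundle *)

Section SubbundleSections.
Context {R : realType} {n : nat} {M : manifold R n} {V : bundle M}.
Implicit Types x : M.

Lemma basis_lin (W : lmodType R) (S : set W) k (e : 'I_k -> W) c v w :
  is_basis S e -> S v -> S w -> S (c *: v + w).
Proof.
move=> [-> _] [a ->] [b ->]; exists (fun i => c * a i + b i).
rewrite scaler_sumr -big_split /=; apply: eq_bigr => i _.
by rewrite scalerDl scalerA.
Qed.

Lemma basis_mem (W : lmodType R) (S : set W) k (e : 'I_k -> W) i :
  is_basis S e -> S (e i).
Proof.
move=> [-> _]; exists (fun j => (j == i)%:R); rewrite (bigD1 i)//= eqxx scale1r.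
by rewrite big1 ?addr0// => j /negPf->; rewrite scale0r.
Qed.

Lemma basis0 (W : lmodType R) (S : set W) k (e : 'I_k -> W) : is_basis S e -> S 0.
Proof. by move=> [-> _]; exists (fun=> 0); rewrite big1// => i _; rewrite scale0r. Qed.

Lemma subbundle_lin (S : forall x, set (V x)) k x c v w : is_subbundle S k ->
  S x v -> S x w -> S x (c *: v + w).
Proof. by move=> /(_ x)[e /nbhs_singleton]; exact: basis_lin. Qed.

Lemma subbundle0 (S : forall x, set (V x)) k x : is_subbundle S k -> S x 0.
Proof. by move=> /(_ x)[e /nbhs_singleton]; exact: basis0. Qed.

Lemma subbundleZ (S : forall x, set (V x)) k x c v : is_subbundle S k ->
  S x v -> S x (c *: v).
Proof.
by move=> SB Sv; have := subbundle_lin c SB Sv (subbundle0 x SB); rewrite addr0.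
Qed.

Lemma secs_sum (S : forall x, set (V x)) k (I : Type) (l : seq I) (F : I -> sec V) :
  is_subbundle S k -> (forall i, secs S (F i)) -> secs S (\sum_(i <- l) F i).
Proof.
move=> SB FS x; rewrite sec_sumE.
elim: l => [|i l IH]; first by rewrite big_nil; exact: subbundle0 SB.
by rewrite big_cons -[F i x]scale1r; apply: subbundle_lin SB _ IH; exact: FS.
Qed.

Lemma secs_fmul (S : forall x, set (V x)) k f s :
  is_subbundle S k -> secs S s -> secs S (fmul f s).
Proof. by move=> SB Ss x; exact: subbundleZ SB (Ss x). Qed.

Lemma sec_through (S : forall x, set (V x)) k x0 (v : V x0) : is_subbundle S k ->
  S x0 v -> exists2 s : sec V, secs S s & s x0 = v.
Proof.
move=> SB Sv; have [e eB] := SB x0; have [SE _] := nbhs_singleton eB.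
move: Sv; rewrite SE => -[a va]; have [c [c1 cU]] := bump_exists eB.
exists (fmul c (\sum_i a i *: e i)) => [x|] /=.
  rewrite sec_sumE; have [Bx|/nbhs_singleton->] := cU x; last first.
    by rewrite scale0r; exact: subbundle0 SB.
  by apply: subbundleZ SB _; rewrite Bx.1; exists a.
by rewrite (nbhs_singleton c1) scale1r sec_sumE va.
Qed.

End SubbundleSections.

(** * Sections of the lifted Dirac structure *)

(** The algebra that ends the converse direction. Write X = d + m, Y = r + n and l = d0 + m0. Then
    [N], [N0] are <n,d>, <n,d0>; [Q], [Q0] are <m,r>, <m0,r>; [D], [D0] are d(p n), d0(p n); and
    [P], [P0] are r(p m), r(a_E). The hypotheses are isotropy of L, equality of the symbols of d and
    d0, and the E-component of b{X,Y} = b{l,Y}. *)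
Lemma zmod_elim (V : zmodType) (N Q P P0 D D0 N0 Q0 : V) : N0 + Q0 = 0 ->
  N - D = N0 - D0 -> D + (Q - P) = D0 + (Q0 - P0) -> N + Q = P - P0.
Proof.
move=> iso S H.
have -> : N = - (D0 + Q0) + D.
  rewrite -[N](subrK D) S; congr (_ + _).
  by move/eqP: iso; rewrite addr_eq0 => /eqP ->; rewrite opprD addrC.
have -> : Q = D0 + Q0 - P0 - D + P.
  by rewrite -(addrA D0) -H [D + _]addrC addrK subrK.
by rewrite addrA addrACA addKr subrr addr0 addrC.
Qed.

Section LiftedSections.
Context {R : realType} {n : nat} {M : manifold R n} {r : nat}
  (E : vector_bundle M r) (r_gt0 : (0 < r)%N) (k : nat)
  (A : projective_Lie_algebroid E k) (L : forall x : M, set (omni E x))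
  (AL : is_lifted A L).
Implicit Types (x : M) (a b : sec (Tau E)) (X Y : sec (omni E)).

Lemma bsec_secs Y : secs L Y -> secs A (bsec Y).
Proof.
by move=> LY x; rewrite bsecE// -(lifted_image AL); exists (Y x) => //; exact: LY.
Qed.

(** The map b from L to A is given as surjective on fibres only. Lifting a frame of A at [x0] to
    sections of L gives images that agree with the frame at [x0] alone; by [perturbed_frame] they
    still generate A nearby, with smooth coefficients, and the same coefficients combine the
    lifts. *)
Lemma local_lift a x0 : secs A a ->
  exists2 Y, secs L Y & \forall y \near x0, bsec Y y = a y.
Proof.
move=> Aa; have [kL LB] := dirac_subbundle (lifted_Dirac AL).
have [e eB] := pla_subbundle A x0.
have thr j : exists Y, secs L Y /\ bmap (Y x0) = e j x0 :> Tau E x0.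
  have := basis_mem j (nbhs_singleton eB); rewrite -(lifted_image AL).
  by move=> [l Ll le]; have [Y LY Yl] := sec_through LB Ll; exists Y; rewrite Yl.
have [Y YP] := choice thr.
have [|||c cE] := @perturbed_frame _ _ _ _ E A k e (fun j => bsec (Y j)) a x0 eB.
- by near=> y => j; apply: bsec_secs; exact: (YP j).1.
- by move=> j; rewrite bsecE// (YP j).2.
- by near=> y; exact: Aa.
exists (\sum_j fmul (c j) (Y j)).
  by apply: (secs_sum _ LB) => j; apply: (secs_fmul _ LB); exact: (YP j).1.
apply: filterS cE => y ->; rewrite bsecE// sec_sumE bmap_sum//.
by apply: eq_bigr => j _; rewrite bsecE// -bmapZ.
Unshelve. all: by end_near. Qed.

(** Apply the Leibniz rule to a bump function equal to 1 near [x], which the anchor of [a]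
    annihilates at [x]. *)
Lemma pla_bracket_near a b b' x : secs A a -> secs A b -> secs A b' ->
  (\forall y \near x, b y = b' y) ->
  pla_bracket A a b x = pla_bracket A a b' x.
Proof.
move=> Aa Ab Ab' bb'; have [c [c1 cU]] := bump_exists bb'.
have E1 : fmul c b = fmul c b'.
  apply: sec_eq => y /=; have [->//|/nbhs_singleton->] := cU y.
  by rewrite !scale0r.
have LA := pla_Lie A.
have := congr1 (fun s => pla_bracket A a s x) E1.
rewrite !(la_leibniz LA)//=.
have -> : (a x).1 c = 0 by exact: (tangent_cst (a x).1 c1).
by rewrite (nbhs_singleton c1) !scale0r !addr0 !scale1r.
Qed.

Lemma pla_bracket_near_l a a' b x : secs A a -> secs A a' -> secs A b ->
  (\forall y \near x, a y = a' y) ->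
  pla_bracket A a b x = pla_bracket A a' b x.
Proof.
move=> Aa Aa' Ab aa'; have LA := pla_Lie A.
rewrite (la_skew LA Aa Ab) (la_skew LA Aa' Ab) /=.
by congr (_ *: _); exact: pla_bracket_near.
Qed.

Lemma omni_formBl x (X Y l : omni E x) :
  omni_form (X - Y) l = omni_form X l - omni_form Y l.
Proof.
rewrite /omni_form -scalerBr; congr (_ *: _).
rewrite -[(X - Y).2]/(X.2 - Y.2) pairingB.
rewrite -[pairing l.2 (X - Y).1]/(pairing l.2 X.1 - pairing l.2 Y.1).
by rewrite opprD addrACA.
Qed.

Lemma omni_form_jet x (u : sec E) (l : omni E x) :
  omni_form (0, jet x u) l = 2^-1 *: l.1 u.
Proof.
rewrite /omni_form /= pairing_jet; congr (_ *: _).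
exact: add0r.
Qed.

Lemma coboundary_inner X :
  is_coboundary L (fun x l => omni_form (X x) l) ->
  restr_inner A (gauge_act (falling X)).
Proof.
move=> [u uE].
(* The factor 2 compensates the factor 1/2 in [omni_form]. *)
pose J : sec (omni E) := sec_pair 0 (jet_sec (2 *: u)).
have LX : secs L (X - J).
  move=> x; rewrite (dirac_perp (lifted_Dirac AL)) => l Ll.
  rewrite -[(X - J) x]/(X x + (-1) *: J x) scaleN1r omni_formBl uE//.
  rewrite -[J x]/((0, jet x (2 *: u)) : omni E x) omni_form_jet gaugeZ scalerA.
  by rewrite mulVf ?pnatr_eq0// scale1r subrr.
have fstE : sec_fst (X - J) = sec_fst X.
  by apply: sec_eq => x; rewrite /= scaler0 addr0.
have sndE : sec_snd (X - J) = sec_snd X - jet_sec (2 *: u) by apply: sec_eq.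
exists (bsec (X - J)); first exact: bsec_secs.
move=> a Aa; apply: sec_eq => x; have [Y LY Ya] := local_lift x Aa.
rewrite -(pla_bracket_near (bsec_secs LX) (bsec_secs LY) Aa Ya).
rewrite -(lifted_bracket AL LX LY).
(* The lift [Y] reproduces [a] only near [x], which is enough since gauge operators are local. *)
transitivity (gauge_act (falling X) (bsec Y) x).
  by apply/esym; exact: gauge_near Ya.
rewrite fallingP// !bsec_courant// fstE; congr (_, _).
rewrite sndE jet_proj_sec_sub gaugeB.
rewrite -[(sec_snd X - jet_sec _) x]/(sec_snd X x + (-1) *: jet x (2 *: u)).
rewrite pairingD pairingZ pairing_jet scaleN1r.
(* Here [t] is r(2u). It enters once through the projection of the jet part of X - J and once
   through the pairing of that part with r, with opposite signs. *)
have AC (V : zmodType) (a1 p q t : V) : a1 - p + q = a1 - (p - t) + (q - t).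
  rewrite opprB [a1 + (t - p)]addrCA -[RHS]addrA.
  by rewrite [X in _ = _ + X]addrA [RHS]addrC subrK.
exact: AC.
Qed.

Lemma inner_coboundary X : (0 < k)%N ->
  restr_inner A (gauge_act (falling X)) ->
  is_coboundary L (fun x l => omni_form (X x) l).
Proof.
move=> k_gt0 [a Aa aE].
(* The candidate is fixed before the point [x], whereas the lift [l0] of [a] below depends on
   [x]. *)
exists (2^-1 *: (jet_proj_sec (sec_snd X) - sec_snd a)) => x l Ll.
have [kL LB] := dirac_subbundle (lifted_Dirac AL).
have [l0 Ll0 l0a] := local_lift x Aa.
(* On sections [bsec Y] the chosen [falling X] agrees with [falling_op], whose explicit formula can
   be compared at [x]. Both sides equal the bracket of [a] with [bsec Y] at [x]. *)
have key Y : secs L Y -> falling_op r_gt0 X x (bsec Y) = falling_op r_gt0 l0 x (bsec Y).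
  move=> LY; rewrite -[LHS]/(gauge_act (falling_op r_gt0 X) (bsec Y) x).
  rewrite -[RHS]/(gauge_act (falling_op r_gt0 l0) (bsec Y) x) !falling_opE.
  rewrite -fallingP// (lifted_bracket AL Ll0 LY) aE; last exact: bsec_secs.
  by apply: pla_bracket_near_l => //; [exact: bsec_secs|exact: bsec_secs|
    apply: filterS l0a => y ->].
have symbE : symb (sec_fst X) x = symb (sec_fst l0) x.
  (* The first vector of a frame of A at [x] is nonzero, so the scalar in front of it in the Leibniz
     rule can be cancelled. *)
  have [e /nbhs_singleton eB] := pla_subbundle A x.
  have := basis_mem (Ordinal k_gt0) eB; rewrite -(lifted_image AL).
  move=> [l1 Ll1 l1e]; have [Y LY Yl1] := sec_through LB Ll1.
  apply: tangent_eq => f.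
  have := key _ (secs_fmul f LB LY).
  rewrite bsecZ// [LHS](falling_at_symbol r_gt0 X x) [RHS](falling_at_symbol r_gt0 l0 x).
  have -> : falling_at X x (bsec Y) = falling_at l0 x (bsec Y) by exact: key.
  move/addrI/eqP; rewrite -subr_eq0 -scalerBl scaler_eq0 subr_eq0 => /orP[/eqP//|].
  rewrite bsecE// Yl1 l1e => /eqP e0; have [_ ind] := eB.
  have := ind (fun j => (j == Ordinal k_gt0)%:R).
  rewrite (bigD1 (Ordinal k_gt0))//= e0 scaler0 add0r big1 => [|j /negPf->].
    by move=> /(_ erefl (Ordinal k_gt0)); rewrite eqxx => /eqP; rewrite oner_eq0.
  by rewrite scale0r.
have [Y LY Yl] := sec_through LB Ll; rewrite -Yl.
set d := sec_fst X x; set d0 := sec_fst l0 x; set g := sec_fst Y x.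
set pY := jet_proj_sec (sec_snd Y).
have snd_falling Z : (falling_at Z x (bsec Y)).2 = sec_fst Z x pY +
    (pairing (sec_snd Z x) g - g (jet_proj_sec (sec_snd Z))).
  rewrite /falling_at bsec_pair// -(jet_defectE (sec_snd Z) (symbP (sec_fst Y) x)).
  by rewrite (_ : sec_snd (sec_pair _ _) = pY)//; exact: sec_eq.
(* The E-component of [key], with the projection of [l0] replaced by that of [a]: the two agree near
   [x], and [g] is local. *)
have H : d pY + (pairing (sec_snd X x) g - g (jet_proj_sec (sec_snd X))) =
         d0 pY + (pairing (sec_snd l0 x) g - g (sec_snd a)).
  rewrite -snd_falling; transitivity (falling_at l0 x (bsec Y)).2.
    by congr snd; exact: key.
  rewrite snd_falling; congr (_ + (_ - _)); apply: gauge_near.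
  apply: filterS l0a => y ya.
  by rewrite -[RHS]/((a y).2) -ya bsec_pair.
have S : pairing (sec_snd Y x) d - d pY = pairing (sec_snd Y x) d0 - d0 pY.
  apply: (pairing_symbol _ (symbP (sec_fst X) x)).
  by rewrite symbE; exact: symbP.
have iso : pairing (sec_snd Y x) d0 + pairing (sec_snd l0 x) g = 0.
  have := Ll0 x; rewrite (dirac_perp (lifted_Dirac AL)) => /(_ _ (LY x)).
  rewrite /omni_form => /eqP; rewrite scaler_eq0 invr_eq0 pnatr_eq0 /=.
  by move/eqP.
rewrite -[LHS]/(2^-1 *: (pairing (sec_snd Y x) d + pairing (sec_snd X x) g)).
rewrite -[RHS]/(g _) gaugeZ gaugeB; congr (_ *: _).
exact: zmod_elim iso S H.
Qed.

End LiftedSections.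

Theorem proposition6p2 (R : realType) (n : nat) (M : manifold R n)
  (r : nat) (E : vector_bundle M r) (k : nat)
  (A : projective_Lie_algebroid E k)
  (L : forall x : M, set (omni E x)) :
  (0 < r)%N -> (0 < k)%N -> is_lifted A L ->
  forall X : sec (omni E), normalizer L X ->
    is_coboundary L (fun x l => omni_form (X x) l) <->
    restr_inner A (gauge_act (falling X)).
Proof.
move=> r_gt0 k_gt0 AL X _; split; first exact: coboundary_inner.
exact: inner_coboundary.
Qed.
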